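(* Let $F_n\in\boldsymbol{D}_S$, $n\in\mathbb{N}$. Let $X_n$ be the set of all points of growth of $F_n$, and let $\gamma_n$, $(\lambda_{n,u})_{u\in\langle X_n\rangle\setminus\{0\}}$ be the parameters of the spectral representation of the characteristic function of $F_n$ (as specified in the context). Then $(F_n)_{n\in\mathbb{N}}$ is $\boldsymbol{D}_S$-stochastically compact in variation if and only if it is $\boldsymbol{D}_S$-relatively compact in variation and $$\liminf_{n\to\infty}\sum_{u\in\langle X_n\rangle\setminus\{0\}}|\lambda_{n,u}|>0.$$
   Context: A discrete distribution function is a function $F(x)=\sum_{k=1}^\infty p_{x_k}I_{x_k}(x)$, $x\in\mathbb{R}$, with distinct real $x_k$, $p_{x_k}\geqslant0$, $\sum_{k=1}^\infty p_{x_k}=1$, where $I_c(x)=1$ if $x\geqslant c$ and $I_c(x)=0$ if $x<c$; its set of points of growth is $X=\{x_k: p_{x_k}>0\}$. $\boldsymbol{D}_S$ is the class of all discrete distribution functions $F$ whose characteristic function $f(t)=\int_{\mathbb{R}}e^{itx}\,dF(x)$ is separated from zero, i.e. there exists $\mu>0$ such that $|f(t)|\geqslant\mu$ for all $t\in\mathbb{R}$. For $Y\subset\mathbb{R}$, $\langle Y\rangle=\bigl\{\sum_{k=1}^m c_ky_k: c_k\in\mathbb{Z},\ y_k\in Y,\ m\in\mathbb{N}\bigr\}$. Sums over the empty set equal zero. Spectral representation: for every $F_n\in\boldsymbol{D}_S$ with set of points of growth $X_n$, the characteristic function has a representation $$f_n(t)=\exp\Bigl\{it\gamma_n+\sum_{u\in\langle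 X_n\rangle\setminus\{0\}}\lambda_{n,u}(e^{itu}-1)\Bigr\},\quad t\in\mathbb{R},$$ with $\gamma_n\in\langle X_n\rangle$, $\lambda_{n,u}\in\mathbb{R}$, $\sum_{u\in\langle X_n\rangle\setminus\{0\}}|\lambda_{n,u}|<\infty$, and the parameters $\gamma_n$ and $\lambda_{n,u}$, $u\in\langle X_n\rangle\setminus\{0\}$, are uniquely determined by $f_n$. A sequence of distribution functions $(F_n)$ converges in variation to a distribution function $F$ if $\|F_n-F\|\to0$ as $n\to\infty$, where $\|\cdot\|$ denotes the total variation on $\mathbb{R}$. The sequence $(F_n)_{n\in\mathbb{N}}$ is called $\boldsymbol{D}_S$-relatively compact in variation if every subsequence of it contains a further subsequence converging in variation to a distribution function from $\boldsymbol{D}_S$; it is called $\boldsymbol{D}_S$-stochastically compact in variation if every subsequence of it contains a further subsequence converging in variation to a nondegenerate distribution function from $\boldsymbol{D}_S$ (nondegenerate means having more than one point of growth). *)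

(* Defs.v *)
From mathcomp Require Import all_boot all_order all_algebra.
From mathcomp Require Import complex.
From mathcomp Require Import all_classical all_reals all_analysis.

Set Implicit Arguments.
Unset Strict Implicit.
Unset Printing Implicit Defensive.
Import Order.TTheory GRing.Theory Num.Theory.
Import numFieldNormedType.Exports.

Local Open Scope classical_set_scope.
Local Open Scope complex_scope.
Local Open Scope ring_scope.

Section complex_analysis.
Context {R : realType}.

Definition expC (z : R[i]) : R[i] :=
  (expR (complex.Re z))%:C * (cos (complex.Im z) +i* sin (complex.Im z)).

(* Componentwise; both components have to be integrable for this to be the
   usual integral. *)
Definition Cintegral d (T : measurableType d) (mu : {measure set T -> \bar R})
    (D : set T) (f : T -> R[i]) : R[i] :=
  (\int[mu]_(x in D) complex.Re (f x)) +i* (\int[mu]_(x in D) complex.Im (f x)).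

(* [esum] is only meaningful for nonnegative families, hence the splitting into
   positive and negative parts; [Csum D f] is the unordered sum of [f] over [D]
   whenever [f] is absolutely summable on [D]. *)
Definition Rsum (T : choiceType) (D : set T) (f : T -> R) : R :=
  fine (esum D (EFin \o f)^\+ - esum D (EFin \o f)^\-)%E.

Definition Csum (T : choiceType) (D : set T) (f : T -> R[i]) : R[i] :=
  Rsum D (fun u => complex.Re (f u)) +i* Rsum D (fun u => complex.Im (f u)).

End complex_analysis.

Section distribution_functions.
Context {R : realType}.

(* Right-continuous nondecreasing functions with limits 0 at -oo, 1 at +oo. *)
Definition distribution_function : Type := cumulativeBounded (0 : R) (1 : R).

Implicit Types F G : distribution_function.

Definition discrete_rep F (x p : nat -> R) : Prop :=
  [/\ injective x,
      forall k, 0 <= p k,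
      (\sum_(k <oo) (p k)%:E = 1)%E &
      forall y, ((F y)%:E = \sum_(k <oo) (p k * \1_(`[x k, +oo[) y)%:E)%E].

Definition discrete F : Prop := exists x p, discrete_rep F x p.

(* For discrete F only; the set is the same for all representations of F. *)
Definition growth_points F : set R :=
  [set c | exists x p, discrete_rep F x p /\ exists2 k, c = x k & 0 < p k].

Definition nondegenerate F : Prop :=
  exists a b, [/\ growth_points F a, growth_points F b & a != b].

Definition char_fun F (t : R) : R[i] :=
  Cintegral (lebesgue_stieltjes_measure F) setT
    (fun x : R => expC ('i * (t * x)%:C)).

Definition DS F : Prop :=
  discrete F /\
  exists2 mu : R, 0 < mu & forall t, mu%:C <= `|char_fun F t|.

Definition int_span (Y : set R) : set R :=
  [set s | exists m (c : 'I_m -> int) (y : 'I_m -> R),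
     [/\ (0 < m)%N, forall k, Y (y k) & s = \sum_(k < m) y k *~ c k]].

Definition spectral_support F : set R := int_span (growth_points F) `\ 0.

(* Only the values of [lam] on [spectral_support F] are relevant. *)
Definition spectral_rep F (gam : R) (lam : R -> R) : Prop :=
  [/\ int_span (growth_points F) gam,
      summable (spectral_support F) (EFin \o lam) &
      forall t, char_fun F t =
        expC ('i * (t * gam)%:C +
              Csum (spectral_support F)
                (fun u => (lam u)%:C * (expC ('i * (t * u)%:C) - 1)))].

Definition total_variationR (f : R -> R) : \bar R :=
  ereal_sup [set total_variation ab.1 ab.2 f
            | ab in [set ab : R * R | ab.1 <= ab.2]].

Definition cvg_in_variation (F : nat -> distribution_function) G : Prop :=
  total_variationR ((F n : R -> R) \- (G : R -> R)) @[n --> \oo] --> 0%E.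

Definition subseq_index (phi : nat -> nat) : Prop :=
  {homo phi : m n / (m < n)%N}.

Definition DS_relatively_compact (F : nat -> distribution_function) : Prop :=
  forall phi, subseq_index phi ->
  exists psi G, [/\ subseq_index psi, DS G &
                    cvg_in_variation (F \o phi \o psi) G].

Definition DS_stochastically_compact (F : nat -> distribution_function) : Prop :=
  forall phi, subseq_index phi ->
  exists psi G, [/\ subseq_index psi, DS G, nondegenerate G &
                    cvg_in_variation (F \o phi \o psi) G].

End distribution_functions.

Arguments distribution_function : clear implicits.

(* Main.v *)
(** If [sum |lam_n,u|] tends to [0] along a subsequence, then
    [|f_n t| >= 1 - 2 sum |lam_n,u|] tends to [1] for every [t]; but convergence
    in variation to a distribution with two atoms [a], [b] keeps mass at both,
    so [|f_n t|] stays away from [1] when [t (a - b) = pi].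

    Conversely, if the limit is degenerate at [a], then
    [f_n(t) e^{-ita} = 1 + r(t)], where [r] is an absolutely convergent
    trigonometric series with small coefficient mass [d]. The exponent [h] of the
    spectral representation of [f_n(t) e^{-ita}] vanishes at [0], so by continuity
    it is the small branch of [ln (1 + r)]; being bounded, it has no linear term.
    Its coefficients are recovered by averaging [h] against characters, and
    expanding the logarithm bounds the mass of any finite set of them by
    [sum_k d^k / k <= 2 d]. Averages are taken over arithmetic progressions
    [t = j tau], with [tau] small enough to separate the finitely many
    frequencies involved. *)
Require Import Defs.
From mathcomp Require Import all_boot all_order all_algebra.
From mathcomp Require Import complex finmap.
From mathcomp Require Import all_classical all_reals all_analysis.
From mathcomp Require Import measurable_realfun.
From mathcomp Require Import ring lra.

Import Order.TTheory GRing.Theory Num.Theory.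
Import numFieldNormedType.Exports.
Import Normc.

Local Open Scope classical_set_scope.
Local Open Scope ring_scope.

(** * Modulus and exponential of complex numbers *)

Section complex_exponential.
Context {R : realType}.
Implicit Types (z w : R[i]) (x y t : R).

Lemma normcD_le z w : normc (z + w) <= normc z + normc w.
Proof. exact: le_normcD. Qed.

Lemma normc_opp z : normc (- z) = normc z.
Proof. exact: normcN. Qed.

Lemma normcB_le z w : normc (z - w) <= normc z + normc w.
Proof. by rewrite -(normc_opp w); exact: normcD_le. Qed.

Lemma normc_ge0 z : 0 <= normc z.
Proof. by case: z => a b; exact: sqrtr_ge0. Qed.

Lemma normc_real x : normc x%:C%C = `|x|.
Proof. by rewrite /normc /= expr0n /= addr0 sqrtr_sqr. Qed.

Lemma normc_exp z n : normc (z ^+ n) = normc z ^+ n.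
Proof. by elim: n => [|n IH]; rewrite ?expr0 ?normc1// !exprS normcM IH. Qed.

Lemma normc_triangle_sub z w : normc z - normc w <= normc (z - w).
Proof. by rewrite lerBlDr; have := normcD_le (z - w) w; rewrite subrK. Qed.

Lemma normc_sum (I : Type) (s : seq I) (P : pred I) (f : I -> R[i]) :
  normc (\sum_(i <- s | P i) f i) <= \sum_(i <- s | P i) normc (f i).
Proof.
elim/big_ind2 : _ => [|z a w b za wb|//]; first by rewrite normc0.
exact: le_trans (normcD_le _ _) (lerD za wb).
Qed.

Lemma normc_Re_Im z : normc z <= `|complex.Re z| + `|complex.Im z|.
Proof.
case: z => a b /=; rewrite -[leRHS]ger0_norm ?addr_ge0// -sqrtr_sqr ler_wsqrtr//.
rewrite sqrrD !real_normK ?num_real// lerD2r lerDl.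
by rewrite mulrn_wge0// mulr_ge0.
Qed.

Lemma Re_normc z : `|complex.Re z| <= normc z.
Proof. by case: z => a b /=; rewrite -sqrtr_sqr ler_wsqrtr// lerDl sqr_ge0. Qed.

Lemma Im_normc z : `|complex.Im z| <= normc z.
Proof. by case: z => a b /=; rewrite -sqrtr_sqr ler_wsqrtr// lerDr sqr_ge0. Qed.

Definition cis x : R[i] := (cos x +i* sin x)%C.

Lemma cisD x y : cis (x + y) = cis x * cis y.
Proof. by rewrite /cis cosD sinD; simpc; congr (_ +i* _)%C; rewrite addrC. Qed.

Lemma cis0 : cis 0 = 1.
Proof. by rewrite /cis cos0 sin0. Qed.

Lemma cisMn x n : cis (x *+ n) = cis x ^+ n.
Proof.
by elim: n => [|n IH]; rewrite ?mulr0n ?cis0// mulrS cisD IH exprS.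
Qed.

Lemma normc_cis x : normc (cis x) = 1.
Proof. by rewrite /cis /= cos2Dsin2 sqrtr1. Qed.

Lemma expCD z w : expC (z + w) = expC z * expC w.
Proof.
case: z w => [a b] [c d]; rewrite /expC /= expRD cosD sinD.
by simpc; congr (_ +i* _)%C; ring.
Qed.

Lemma expC0 : expC (0 : R[i]) = 1.
Proof. by rewrite /expC /= expR0 cos0 sin0; simpc. Qed.

Lemma expC_i y : expC ('i * y%:C)%C = cis y.
Proof. by rewrite /expC /cis; simpc; rewrite /= expR0; simpc. Qed.

Lemma normc_expC z : normc (expC z) = expR (complex.Re z).
Proof.
by rewrite /expC normcM (normc_cis (complex.Im z)) mulr1 normc_real ger0_norm ?expR_ge0.
Qed.

End complex_exponential.

(** * The complex logarithm series *)

Section complex_logarithm.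
Context {R : realType}.
Implicit Types (f g : R -> R[i]) (s x : R) (w : R[i]).

(** Derivative in a real variable, split into components so that the real mean value theorem applies
    to each of them. *)
Definition is_cderive f s (l : R[i]) : Prop :=
  is_derive s 1 (fun x => complex.Re (f x)) (complex.Re l) /\
  is_derive s 1 (fun x => complex.Im (f x)) (complex.Im l).

Lemma is_cderive_cst w s : is_cderive (fun=> w) s 0.
Proof. by split; exact: is_derive_cst. Qed.

Lemma is_cderiveD f g s l m : is_cderive f s l -> is_cderive g s m ->
  is_cderive (fun x => f x + g x) s (l + m).
Proof.
move=> [fr fi] [gr gi]; split.
- have -> : (fun x => complex.Re (f x + g x)) =
    (fun x => complex.Re (f x)) \+ (fun x => complex.Re (g x)).
    by apply/funext => x /=; rewrite raddfD.
  by rewrite raddfD; exact: is_deriveD.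
- have -> : (fun x => complex.Im (f x + g x)) =
    (fun x => complex.Im (f x)) \+ (fun x => complex.Im (g x)).
    by apply/funext => x /=; rewrite raddfD.
  by rewrite raddfD; exact: is_deriveD.
Qed.

Lemma ReD (z w : R[i]) : complex.Re (z + w) = complex.Re z + complex.Re w.
Proof. by case: z w => a b []. Qed.

Lemma ImD (z w : R[i]) : complex.Im (z + w) = complex.Im z + complex.Im w.
Proof. by case: z w => a b []. Qed.

Lemma is_cderiveM f g s l m : is_cderive f s l -> is_cderive g s m ->
  is_cderive (fun x => f x * g x) s (l * g s + f s * m).
Proof.
move=> [fr fi] [gr gi].
have ReM (z w : R[i]) : complex.Re (z * w) =
    complex.Re z * complex.Re w - complex.Im z * complex.Im w.
  by case: z w => a b [c d]; simpc.
have ImM (z w : R[i]) : complex.Im (z * w) =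
    complex.Re z * complex.Im w + complex.Im z * complex.Re w.
  by case: z w => a b [c d]; simpc; rewrite addrC.
split.
- have -> : (fun x => complex.Re (f x * g x)) =
    (fun x => complex.Re (f x)) * (fun x => complex.Re (g x)) -
    (fun x => complex.Im (f x)) * (fun x => complex.Im (g x)).
    by apply/funext => x; rewrite ReM.
  apply: is_derive_eq; rewrite ReD !ReM /GRing.scale/=; ring.
- have -> : (fun x => complex.Im (f x * g x)) =
    (fun x => complex.Re (f x)) * (fun x => complex.Im (g x)) +
    (fun x => complex.Im (f x)) * (fun x => complex.Re (g x)).
    by apply/funext => x; rewrite ImM.
  apply: is_derive_eq; rewrite ImD !ImM /GRing.scale/=; ring.
Qed.

Lemma is_cderiveX f n s l : is_cderive f s l ->
  is_cderive (fun x => f x ^+ n.+1) s (n.+1%:R * f s ^+ n * l).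
Proof.
move=> fl; elim: n => [|n IH].
  have -> : (fun x => f x ^+ 1) = f by apply/funext => x; rewrite expr1.
  by rewrite expr0 !mul1r.
have -> : (fun x => f x ^+ n.+2) = (fun x => f x * f x ^+ n.+1).
  by apply/funext => x; rewrite exprS.
have := is_cderiveM _ _ _ _ _ fl IH.
by congr is_cderive; rewrite exprS -[n.+2%:R]natr1; ring.
Qed.

Lemma is_cderive_sum n (F : nat -> R -> R[i]) s (l : nat -> R[i]) :
  (forall k, is_cderive (F k) s (l k)) ->
  is_cderive (fun x => \sum_(k < n) F k x) s (\sum_(k < n) l k).
Proof.
move=> Fl; elim: n => [|n IH].
  rewrite big_ord0 (_ : (fun x => _) = fun=> 0); first exact: is_cderive_cst.
  by apply/funext => x; rewrite big_ord0.
rewrite big_ord_recr/=.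
rewrite (_ : (fun x => _) = (fun x => \sum_(k < n) F k x + F n x)).
  exact: is_cderiveD.
by apply/funext => x; rewrite big_ord_recr.
Qed.

Lemma is_derive_mulr (a s : R) : is_derive s 1 (fun x => x * a) a.
Proof.
have -> : (fun x => x * a) = id * cst a by [].
by apply: is_derive_eq; rewrite /GRing.scale/= mulr0 add0r mulr1.
Qed.

Lemma is_cderive_exp w s :
  is_cderive (fun x => expC (x%:C%C * w)) s (w * expC (s%:C%C * w)).
Proof.
case: w => a b.
have E x : expC (x%:C%C * (a +i* b)%C) =
    (expR (x * a) * cos (x * b) +i* (expR (x * a) * sin (x * b)))%C.
  by rewrite /expC; simpc.
rewrite E; split.
- under eq_fun do rewrite E.
  simpc => /=.
  have -> : (fun x => expR (x * a) * cos (x * b)) =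
    (expR \o (fun x => x * a)) * (cos \o (fun x => x * b)) by [].
  have da : is_derive s 1 (fun x => x * a) a.
    exact: is_derive_mulr.
  have db : is_derive s 1 (fun x => x * b) b.
    exact: is_derive_mulr.
  have d1 := is_derive1_comp (g := fun x => x * a) (is_derive_expR (s * a)) da.
  have d2 := is_derive1_comp (g := fun x => x * b) (is_derive_cos (s * b)) db.
  by apply: is_derive_eq; rewrite /GRing.scale/=; ring.
- under eq_fun do rewrite E.
  simpc => /=.
  have -> : (fun x => expR (x * a) * sin (x * b)) =
    (expR \o (fun x => x * a)) * (sin \o (fun x => x * b)) by [].
  have da : is_derive s 1 (fun x => x * a) a.
    exact: is_derive_mulr.
  have db : is_derive s 1 (fun x => x * b) b.
    exact: is_derive_mulr.
  have d1 := is_derive1_comp (g := fun x => x * a) (is_derive_expR (s * a)) da.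
  have d2 := is_derive1_comp (g := fun x => x * b) (is_derive_sin (s * b)) db.
  by apply: is_derive_eq; rewrite /GRing.scale/=; ring.
Qed.

Lemma is_cderive_lin w s : is_cderive (fun x => x%:C%C * w) s w.
Proof.
case: w => a b; split.
- have -> : (fun x => complex.Re (x%:C%C * (a +i* b)%C)) = (fun x => x * a).
    by apply/funext => x; simpc.
  exact: is_derive_mulr.
- have -> : (fun x => complex.Im (x%:C%C * (a +i* b)%C)) = (fun x => x * b).
    by apply/funext => x; simpc.
  exact: is_derive_mulr.
Qed.

Lemma real_mvt_le (f df : R -> R) M :
  (forall s, is_derive s 1 f (df s)) ->
  (forall s, 0 <= s <= 1 -> `|df s| <= M) -> `|f 1 - f 0| <= M.
Proof.
move=> fdf dfM.
have cf : {within `[0, 1], continuous f}.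
  apply: continuous_subspaceT => c; apply: differentiable_continuous.
  by apply/derivable1_diffP; have [] := fdf c.
have [c c01 ->] := MVT ltr01 (fun s _ => fdf s) cf.
rewrite subr0 mulr1; apply: dfM.
by move: c01; rewrite in_itv/= => /andP[/ltW -> /ltW ->].
Qed.

(** The mean value theorem has no exact complex form; applying it to the real and imaginary parts
    separately costs the factor [2]. *)
Lemma cmvt_le f df M :
  (forall s, is_cderive f s (df s)) ->
  (forall s, 0 <= s <= 1 -> normc (df s) <= M) -> normc (f 1 - f 0) <= 2 * M.
Proof.
move=> fdf dfM; apply: le_trans (normc_Re_Im _) _.
rewrite !raddfB/= mulr_natl mulr2n; apply: lerD.
- apply: (real_mvt_le (fun s => complex.Re (f s)) (fun s => complex.Re (df s))) => s.
  + by have [] := fdf s.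
  + by move=> /dfM; exact/le_trans/Re_normc.
- apply: (real_mvt_le (fun s => complex.Im (f s)) (fun s => complex.Im (df s))) => s.
  + by have [] := fdf s.
  + by move=> /dfM; exact/le_trans/Im_normc.
Qed.

Lemma expR_half_le2 x : x <= 1/2 -> expR x <= 2.
Proof.
move=> x2; have := @expR_ge1Dx R (- x).
rewrite expRN => h; rewrite -[expR x]invrK -[leRHS]invrK lef_pV2 ?posrE ?invr_gt0 ?expR_gt0//.
by apply: le_trans h; lra.
Qed.

(** Along the segment [x w], the derivative [w * expC (x w)] has modulus at most [2 |w|]; [cmvt_le]
    doubles this. *)
Lemma normc_expC_sub1_le w : normc w <= 1/2 -> normc (expC w - 1) <= 4 * normc w.
Proof.
move=> w2.
pose f x := expC (x%:C%C * w).
have -> : expC w - 1 = f 1 - f 0.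
  by rewrite /f mul1r (_ : 0%:C%C = 0)// mul0r expC0.
have -> : 4 * normc w = 2 * (2 * normc w) by ring.
apply: (cmvt_le f (fun s => w * expC (s%:C%C * w))).
  exact: is_cderive_exp.
move=> s /andP[s0 s1]; rewrite normcM mulrC ler_wpM2r ?normc_ge0// normc_expC.
apply: expR_half_le2; apply: le_trans w2.
apply: le_trans (ler_norm _) _; apply: le_trans (Re_normc _) _.
by rewrite normcM normc_real ger0_norm// ler_piMl ?normc_ge0.
Qed.

(* Along [x w], [0 <= x <= 1], the error of the truncated series of
   [ln (1 + (exp (x w) - 1))] has derivative [- w (1 - exp (x w))^K]. *)
Lemma log_series_approx w K : normc w <= 1/16 ->
  normc (\sum_(k < K) (-1) ^+ k / k.+1%:R * (expC w - 1) ^+ k.+1 - w)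
    <= 2 * (normc w * (1/4) ^+ K).
Proof.
move=> w16.
pose e x := expC (x%:C%C * w) - 1.
pose c (k : nat) : R[i] := (-1) ^+ k / k.+1%:R.
pose f x := \sum_(k < K) c k * e x ^+ k.+1 + x%:C%C * (- w).
have f1 : f 1 = \sum_(k < K) c k * (expC w - 1) ^+ k.+1 - w.
  by rewrite /f /e !mul1r.
have f0 : f 0 = 0.
  rewrite /f (_ : 0%:C%C = 0)// mul0r addr0 big1// => k _.
  by rewrite /e (_ : 0%:C%C = 0)// mul0r expC0 subrr expr0n/= mulr0.
rewrite -[X in normc X]f1 -[f 1]subr0 -f0.
apply: (cmvt_le f (fun s => - w * (- e s) ^+ K)); last first.
  move=> s /andP[s0 s1]; rewrite normcM normc_opp ler_wpM2l ?normc_ge0//.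
  rewrite normc_exp normc_opp lerXn2r ?nnegrE ?normc_ge0 ?divr_ge0//.
  have sw : normc (s%:C%C * w) <= normc w.
    by rewrite normcM normc_real ger0_norm// ler_piMl ?normc_ge0.
  (* [|e s| <= 4 |s w| <= 4/16], whence the ratio [1/4]. *)
  apply: le_trans (normc_expC_sub1_le _ _) _; lra.
move=> s.
have de : is_cderive e s (w * expC (s%:C%C * w)).
  have := is_cderiveD _ _ _ _ _ (is_cderive_exp w s) (is_cderive_cst (-1) s).
  by rewrite addr0.
(* The coefficient [1 / (k + 1)] cancels the exponent, which leaves a geometric progression of ratio
   [- e s]. *)
have dc k : is_cderive (fun x => c k * e x ^+ k.+1) s
    ((- e s) ^+ k * (w * expC (s%:C%C * w))).
  have := is_cderiveM _ _ _ _ _ (is_cderive_cst (c k) s) (is_cderiveX _ k _ _ de).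
  congr is_cderive; rewrite mul0r add0r !mulrA /c; congr (_ * _ * _).
  by rewrite mulfVK ?pnatr_eq0// -[in RHS]mulN1r exprMn.
have := is_cderiveD _ _ _ _ _ (is_cderive_sum K _ _ _ dc) (is_cderive_lin (- w) s).
congr is_cderive; rewrite -mulr_suml.
have -> : expC (s%:C%C * w) = 1 - (- e s) by rewrite /e; ring.
(* Summing the progression gives [(1 - (- e s)) * S = 1 - (- e s) ^ K]; the [1] cancels against the
   derivative [- w] of the linear term. *)
have := subrX1 (- e s) K; set S := \sum_(i < K) _ => SE.
have -> : S * (w * (1 - - e s)) = - w * ((- e s - 1) * S) by ring.
by rewrite -SE; ring.
Qed.

(** For [K = 1] the logarithmic series gives [|(expC w - 1) - w| <= |w| / 2]. *)
Lemma normc_le_expC_sub1 w : normc w <= 1/16 -> normc w <= 2 * normc (expC w - 1).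
Proof.
move=> w16.
have := log_series_approx w 1 w16; rewrite big_ord1 expr0 !expr1 divr1 mul1r.
have := normc_triangle_sub w (expC w - 1).
by rewrite -(normc_opp (w - _)) opprB; lra.
Qed.

End complex_logarithm.

(** * Means along arithmetic progressions *)

Section means.
Context {R : realType}.
Implicit Types (q r : nat -> R[i]) (z : R[i]) (A B : R).

(** The upper limit of the moduli of the Cesaro means is at most [B]; the means themselves need not
    converge. *)
Definition mean_le q B : Prop := forall e : R, 0 < e ->
  exists n0, forall n, (n0 <= n)%N -> normc (\sum_(j < n) q j) <= (B + e) * n%:R.

Lemma mean_leD q r A B : mean_le q A -> mean_le r B ->
  mean_le (fun j => q j + r j) (A + B).
Proof.
move=> qA rB e e0; have e20 : 0 < e / 2 by lra.
have [n1 h1] := qA _ e20; have [n2 h2] := rB _ e20.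
exists (maxn n1 n2) => n; rewrite geq_max => /andP[/h1 {}h1 /h2 {}h2].
rewrite big_split/=; apply: le_trans (normcD_le _ _) _.
by apply: le_trans (lerD h1 h2) _; lra.
Qed.

Lemma mean_le_bounded q B : (forall j, normc (q j) <= B) -> mean_le q B.
Proof.
move=> qB e e0; exists 0%N => n _; apply: le_trans (normc_sum _ _ _ _) _.
apply: (@le_trans _ _ (\sum_(j < n) B)); first by apply: ler_sum => j _.
rewrite sumr_const card_ord -[B *+ n]mulr_natr ler_wpM2r//; lra.
Qed.

Lemma mean_le_monotone q A B : A <= B -> mean_le q A -> mean_le q B.
Proof.
move=> AB qA e e0; have [n0 h] := qA _ e0; exists n0 => n /h /le_trans; apply.
by rewrite ler_wpM2r// lerD2r.
Qed.

Lemma mean_le_scale z q B : mean_le q B ->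
  mean_le (fun j => z * q j) (normc z * B).
Proof.
move=> qB e e0.
(* Adding [1] keeps the divisor positive when [z = 0]. *)
have c0 : 0 < normc z + 1 by have := normc_ge0 z; lra.
have [|n0 h] := qB (e / (normc z + 1)); first by rewrite divr_gt0.
exists n0 => n /h {}h; rewrite -mulr_sumr normcM.
apply: le_trans (ler_wpM2l (normc_ge0 z) h) _.
rewrite mulrA ler_wpM2r// mulrDr lerD2l mulrCA ler_piMr ?(ltW e0)//.
by rewrite ler_pdivrMr// mul1r; lra.
Qed.

(** The partial sums [(z ^ n - 1) / (z - 1)] stay below [2 / |z - 1|], so division by [n] sends them
    to [0]. *)
Lemma mean_le_geometric z : normc z = 1 -> z != 1 -> mean_le (fun j => z ^+ j) 0.
Proof.
move=> z1 zn1 e e0.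
have d0 : 0 < normc (z - 1).
  rewrite lt_neqAle normc_ge0 andbT eq_sym; apply/eqP => /eq0_normc /eqP.
  by rewrite subr_eq0; exact/negP.
exists (Num.truncn (2 / (e * normc (z - 1)))).+1 => n n0; rewrite add0r.
rewrite -(ler_pM2l d0) -normcM -subrX1.
apply: (@le_trans _ _ 2).
  by apply: le_trans (normcB_le _ _) _; rewrite normc_exp z1 expr1n normc1; lra.
have : 2 / (e * normc (z - 1)) <= n%:R.
  have := truncnS_gt (2 / (e * normc (z - 1))).
  move=> /ltW /le_trans; apply; by rewrite ler_nat.
rewrite ler_pdivrMr ?mulr_gt0//; lra.
Qed.

Lemma mean_le_const z B : mean_le (fun=> z) B -> normc z <= B.
Proof.
move=> h; apply/ler_addgt0Pr => e e0; have [n0 /(_ n0.+1 (leqnSn _))] := h e e0.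
by rewrite sumr_const card_ord normcMn -[normc z *+ _]mulr_natr ler_pM2r.
Qed.

Lemma mean_le_sum (I : eqType) (s : seq I) (q : I -> nat -> R[i]) (B : I -> R) :
  {in s, forall i, mean_le (q i) (B i)} ->
  mean_le (fun j => \sum_(i <- s) q i j) (\sum_(i <- s) B i).
Proof.
elim: s => [_|i s IH qB].
  rewrite big_nil; apply: mean_le_bounded => j.
  by rewrite big_nil normc0.
under [X in mean_le X]eq_fun do rewrite big_cons.
rewrite big_cons; apply: (mean_leD (q i) (fun j => \sum_(i <- s) q i j)).
  by apply: qB; rewrite mem_head.
by apply: IH => k ks; apply: qB; rewrite inE ks orbT.
Qed.

(* Every upper Fourier-Bohr coefficient of [q] is at most [B]. *)
Definition mod_mean_le q B : Prop :=
  forall th, mean_le (fun j => q j * cis th ^+ j) B.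

Definition bounded_seq q : Prop := exists A, forall j, normc (q j) <= A.

(* [r] acts on bounded sequences like an absolutely convergent trigonometric
   series whose coefficients have total mass at most [d]. *)
Definition wiener_le r (d : R) : Prop := forall q B,
  bounded_seq q -> mod_mean_le q B -> mod_mean_le (fun j => r j * q j) (d * B).

Lemma bounded_seqXM r q k : bounded_seq r -> bounded_seq q ->
  bounded_seq (fun j => r j ^+ k * q j).
Proof.
move=> [A rA] [D qD]; exists (A ^+ k * D) => j.
rewrite normcM normc_exp ler_pM ?exprn_ge0 ?normc_ge0//.
by rewrite lerXn2r ?nnegrE ?normc_ge0// (le_trans (normc_ge0 _) (rA j)).
Qed.

(** Since [wiener_le] quantifies over all bounded sequences, it can be iterated: [r ^ k * q] is
    again an admissible argument. *)
Lemma wiener_leX r d q B k : bounded_seq r -> wiener_le r d ->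
  bounded_seq q -> mod_mean_le q B ->
  mod_mean_le (fun j => r j ^+ k * q j) (d ^+ k * B).
Proof.
move=> br rd bq qB; elim: k => [|k IH].
  by under [X in mod_mean_le X]eq_fun do rewrite expr0 mul1r; rewrite expr0 mul1r.
under [X in mod_mean_le X]eq_fun do rewrite exprS -mulrA.
by rewrite exprS -mulrA; apply: (rd (fun j => r j ^+ k * q j)) => //; exact: bounded_seqXM.
Qed.

(** Multiplication by [c i * cis (th i) ^ j] shifts the frequency by [th i] and scales the bound by
    [|c i|]; the uniform remainder is harmless against a bounded [q]. *)
Lemma wiener_le_trig (I : eqType) (r : nat -> R[i]) (d : R) :
  (forall e : R, 0 < e -> exists (s : seq I) (c : I -> R[i]) (th : I -> R),
    \sum_(i <- s) normc (c i) <= d /\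
    forall j, normc (r j - \sum_(i <- s) c i * cis (th i) ^+ j) <= e) ->
  wiener_le r d.
Proof.
move=> rP q B [A qA] qB.
have A0 : 0 <= A by apply: le_trans (normc_ge0 _) (qA 0%N).
(* With [B < 0], the tolerance [- B / 2] would bound a modulus by a negative number. *)
have B0 : 0 <= B.
  rewrite leNgt; apply/negP => Bn; have [|n0 /(_ n0.+1 (leqnSn _))] := qB 0 (- B / 2).
    lra.
  rewrite leNgt => /negP; apply; apply: lt_le_trans _ (normc_ge0 _).
  by rewrite pmulr_llt0 ?ltr0Sn//; lra.
move=> ph e e0.
have e20 : 0 < e / 2 by lra.
(* The remainder times [|q j| <= A] must stay below [e / 2]; the [+ 1] covers [A = 0]. *)
have [|s [c [th [sd rs]]]] := rP (e / 2 / (A + 1)); first by rewrite divr_gt0//; lra.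
suff [n0 h] : exists n0, forall n, (n0 <= n)%N ->
    normc (\sum_(j < n) (\sum_(i <- s) c i * (q j * cis (th i + ph) ^+ j)
      + (r j - \sum_(i <- s) c i * cis (th i) ^+ j) * (q j * cis ph ^+ j)))
      <= (d * B + e / 2 + e / 2) * n%:R.
  exists n0 => n /h; rewrite -addrA -splitr; apply: le_trans.
  rewrite le_eqVlt; apply/orP; left; apply/eqP; congr normc; apply: eq_bigr => j _.
  rewrite mulrBl addrC mulr_suml -addrA -sumrN -big_split/= big1 ?addr0 ?mulrA// => i _.
  rewrite cisD exprMn; ring.
apply: (mean_leD (fun j => \sum_(i <- s) c i * (q j * cis (th i + ph) ^+ j))
  (fun j => (r j - \sum_(i <- s) c i * cis (th i) ^+ j) * (q j * cis ph ^+ j))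
  (d * B) (e / 2)) e20.
- apply: (mean_le_monotone _ (\sum_(i <- s) normc (c i) * B)).
    by rewrite -mulr_suml ler_wpM2r.
  apply: mean_le_sum => i _; apply: mean_le_scale; exact: qB.
- apply: mean_le_bounded => j; rewrite !normcM normc_exp normc_cis expr1n mulr1.
  apply: le_trans (ler_pM _ _ (rs j) (qA j)) _; rewrite ?normc_ge0//.
  by rewrite mulrAC ler_pdivrMr ?ler_wpM2l ?(ltW e20)//; lra.
Qed.

End means.

(** * Coefficient mass of the logarithm of a trigonometric series *)

Section wiener_logarithm.
Context {R : realType}.
Implicit Types (U V : seq R) (lam : R -> R) (t u v x tau : R).

(** Since [2 <= pi], injectivity of the cosine on [[0, pi]] applies to [|x|]. *)
Lemma cis_neq1 x : x != 0 -> `|x| <= 2 -> cis x != 1.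
Proof.
move=> x0 x2; apply/eqP => -[cx _].
have [pi2 pi0] : 2 <= (pi : R) /\ 0 <= (pi : R) by have := @pi_ge2 R; split; lra.
have : cos `|x| = cos 0.
  by rewrite cos0 -cx; case: (ger0P x) => // _; rewrite cosN.
move/cos_inj; rewrite !in_itv/= !normr_ge0 lexx pi0 (le_trans x2 pi2) => /(_ isT isT).
by move/eqP; rewrite normr_eq0 (negbTE x0).
Qed.

(** If [M] bounds [V], the step [1 / (M + 1)] keeps [|(u - v) * tau| <= 2], so distinct frequencies
    are not identified along the progression. *)
Lemma separating_step V : exists2 tau : R, 0 < tau &
  {in V &, forall u v, u != v -> cis ((u - v) * tau) != 1}.
Proof.
have [M M0 VM] : exists2 M : R, 0 <= M & {in V, forall u, `|u| <= M}.
  elim: V => [|v V [M M0 VM]]; first by exists 0.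
  exists (M + `|v|); first by rewrite addr_ge0.
  by move=> u; rewrite inE => /predU1P[->|/VM]; have := normr_ge0 v; lra.
exists (M + 1)^-1; first by rewrite invr_gt0; lra.
move=> u v /VM uM /VM vM uv; apply: cis_neq1.
  by rewrite mulf_neq0 ?subr_eq0// invr_eq0; apply/eqP; lra.
rewrite normrM normfV (ger0_norm (_ : 0 <= M + 1)) ?ler_pdivrMr; [|lra..].
by apply: le_trans (ler_normB _ _) _; lra.
Qed.

(** After modulation by [th], at most one [v] can resonate, as two would violate the separation; all
    other characters average to [0]. *)
Lemma mod_mean_le_characters V (c : R -> R) tau : uniq V ->
  (forall v, `|c v| <= 1) ->
  {in V &, forall u v, u != v -> cis ((u - v) * tau) != 1} ->
  mod_mean_le (fun j => \sum_(v <- V) (c v)%:C%C * cis (- v * tau) ^+ j) 1.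
Proof.
move=> uV c1 sepV th.
have -> : (fun j : nat => (\sum_(v <- V) (c v)%:C%C * cis (- v * tau) ^+ j) * cis th ^+ j) =
    (fun j => \sum_(v <- V) (c v)%:C%C * cis (th - v * tau) ^+ j).
  apply/funext => j; rewrite mulr_suml; apply: eq_bigr => v _.
  by rewrite -mulrA -exprMn -cisD; congr (_ * cis _ ^+ _); ring.
apply: (mean_le_monotone _ (\sum_(v <- V) (cis (th - v * tau) == 1)%:R)).
  rewrite -natr_sum -(big_map (fun v => cis (th - v * tau)) xpredT (fun z => nat_of_bool (z == 1))).
  rewrite -big_mkcond/= sum1_count count_uniq_mem ?lern1 ?leq_b1//.
  rewrite map_inj_in_uniq// => u v uinV vinV; apply: contra_eq => uv.
  apply/eqP => zuv; have := sepV u v uinV vinV uv; apply/negP; rewrite negbK.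
  have <- : cis (th - u * tau) * cis (u * tau - th) = 1 by rewrite -cisD -cis0; congr cis; ring.
  by rewrite zuv -cisD; apply/eqP; congr cis; ring.
apply: mean_le_sum => v _.
apply: (mean_le_monotone _ (normc (c v)%:C%C * (cis (th - v * tau) == 1)%:R)).
  by rewrite normc_real ler_piMl.
apply: mean_le_scale; have [z1|zn1] := eqVneq (cis (th - v * tau)) 1.
  by apply: mean_le_bounded => j; rewrite z1 expr1n normc1.
by apply: mean_le_geometric; rewrite ?normc_cis.
Qed.

Lemma real_complex_sum (I : Type) (s : seq I) (f : I -> R) :
  ((\sum_(i <- s) f i)%:C)%C = \sum_(i <- s) (f i)%:C%C.
Proof. exact: raddf_sum. Qed.

Lemma geometric_le (d : R) K : 0 <= d -> d <= 1/2 -> \sum_(k < K) d ^+ k.+1 <= 2 * d.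
Proof.
move=> d0 d12; have -> : \sum_(k < K) d ^+ k.+1 = d * \sum_(k < K) d ^+ k.
  by rewrite mulr_sumr; apply: eq_bigr => k _; rewrite exprS.
rewrite mulrC ler_wpM2r//.
have := subrX1 d K; set S := \sum_(i < K) _ => SE.
have dK : 0 <= d ^+ K by rewrite exprn_ge0.
have S0 : 0 <= S by apply: sumr_ge0 => k _; rewrite exprn_ge0.
have : (1/2) * S <= (1 - d) * S by rewrite ler_wpM2r//; lra.
lra.
Qed.

(** In the expanded product the diagonal [u = v] gives the constant [lam v * sg (lam v) = |lam v|].
    Off the diagonal the frequency is [u - v], and the [- 1] gives the frequency [- v]; both are
    nonzero and average to [0]. This is why [0] must be separated from [U] as well. *)
Lemma mean_le_log_trig V U lam tau : uniq V -> uniq U ->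
  {subset V <= U} -> 0 \notin U ->
  {in 0 :: U &, forall u v, u != v -> cis ((u - v) * tau) != 1} ->
  mean_le (fun j : nat =>
    (\sum_(v <- V) `|lam v|)%:C%C -
    (\sum_(u <- U) (lam u)%:C%C * (cis (tau *+ j * u) - 1)) *
    (\sum_(v <- V) (Num.sg (lam v))%:C%C * cis (- v * tau) ^+ j)) 0.
Proof.
move=> uV uU VU U0 sep.
pose a u v : R[i] := (lam u)%:C%C * (Num.sg (lam v))%:C%C.
pose z u v := cis ((u - v) * tau).
have E j : (\sum_(v <- V) `|lam v|)%:C%C -
    (\sum_(u <- U) (lam u)%:C%C * (cis (tau *+ j * u) - 1)) *
    (\sum_(v <- V) (Num.sg (lam v))%:C%C * cis (- v * tau) ^+ j) =
    \sum_(v <- V) \sum_(u <- U)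
      ((if u == v then 0 else - a u v) * z u v ^+ j + a u v * z 0 v ^+ j).
  rewrite real_complex_sum mulr_sumr -sumrB; apply: eq_big_seq => v vV.
  have Ev : (`|lam v|)%:C%C = \sum_(u <- U) (if u == v then a v v else 0).
    rewrite (bigD1_seq v) ?VU//= eqxx big1 ?addr0; last by move=> u /negbTE ->.
    by rewrite /a mulrC -rmorphM/= -normrEsg.
  rewrite Ev mulr_suml -sumrB; apply: eq_bigr => u _.
  have -> : cis (tau *+ j * u) = cis (u * tau) ^+ j.
    by rewrite -cisMn; congr cis; rewrite mulrnAl mulrC.
  have -> : z u v = cis (u * tau) * cis (- v * tau) by rewrite -cisD; congr cis; ring.
  have -> : z 0 v = cis (- v * tau) by congr cis; ring.
  rewrite exprMn; case: eqVneq => [->|uv]; last by rewrite /a; ring.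
  have XY : cis (v * tau) ^+ j * cis (- v * tau) ^+ j = 1.
    by rewrite -exprMn -cisD mulNr subrr cis0 expr1n.
  transitivity (a v v - a v v * (cis (v * tau) ^+ j * cis (- v * tau) ^+ j) +
    a v v * cis (- v * tau) ^+ j); first by rewrite /a; ring.
  by rewrite XY; ring.
rewrite (funext E).
apply: (mean_le_monotone _ (\sum_(v <- V) \sum_(u <- U) (0 : R))).
  by rewrite big1// => v _; rewrite big1.
apply: (mean_le_sum _ V (fun v j => \sum_(u <- U) (_ * z u v ^+ j + _)))
  => v vV.
apply: (mean_le_sum _ U (fun u j => _ * z u v ^+ j + _ * z 0 v ^+ j) (fun=> 0)) => u uinU.
rewrite -[X in mean_le _ X]addr0; apply: mean_leD.
- case: eqVneq => [_|uv].
    by apply: mean_le_bounded => j; rewrite mul0r normc0.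
  rewrite -(mulr0 (normc (- a u v))); apply: mean_le_scale.
  apply: mean_le_geometric; rewrite ?normc_cis// sep// inE ?uinU ?VU ?orbT//.
- rewrite -[X in mean_le _ X](mulr0 (normc (a u v))); apply: mean_le_scale.
  apply: mean_le_geometric; rewrite ?normc_cis// sep// ?mem_head// ?inE ?VU ?orbT//.
  by apply: contraNneq U0 => ->; exact: VU.
Qed.

(* Testing the logarithm [h] of [1 + r] against the trigonometric polynomial
   with coefficients [sg (lam v)] on [V] recovers [\sum_(v <- V) |lam v|], while
   the powers of [r] in the logarithmic series contribute at most those of [d]. *)
Lemma wiener_log_bound (S : set R) lam (h : R -> R[i]) (d : R) V :
  ~ S 0 ->
  (forall (W : seq R) (e : R), 0 < e -> {in W, forall u, S u} -> exists U : seq R,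
    [/\ uniq U, {subset W <= U}, {in U, forall u, S u} &
     forall t, normc (h t - \sum_(u <- U) (lam u)%:C%C * (cis (t * u) - 1)) <= e]) ->
  (forall t, normc (h t) <= 1/16) ->
  0 <= d -> d <= 1/2 ->
  (forall tau, wiener_le (fun j => expC (h (tau *+ j)) - 1) d) ->
  uniq V -> {in V, forall u, S u} ->
  \sum_(v <- V) `|lam v| <= 2 * d.
Proof.
move=> S0 hU h16 d0 d12 rd uV VS.
suff H K : \sum_(v <- V) `|lam v| <= 2 * d + 2 * (size V)%:R * (1/4) ^+ K.
  apply/ler_addgt0Pr => e e0.
  (* As [K + 1 <= 4 ^ K], this [K] brings the error below [e]. *)
  pose K := Num.truncn (2 * (size V)%:R / e).
  apply: le_trans (H K) _; rewrite lerD2l.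
  have /ltW : 2 * (size V)%:R / e < K.+1%:R := truncnS_gt _.
  rewrite ler_pdivrMr// => HK.
  rewrite expr_div_n expr1n mul1r ler_pdivrMr ?exprn_gt0//.
  apply: le_trans HK _; rewrite mulrC ler_wpM2l ?(ltW e0)//.
  by rewrite -natrX ler_nat ltn_expl.
have e0 : 0 < (1/4 : R) ^+ K by rewrite exprn_gt0//; lra.
(* The accuracy [(1/4) ^ K] matches the truncation error of the logarithm at order [K]. *)
have [U [uU VU US hUe]] := hU V _ e0 VS.
have U0 : 0 \notin U by apply/negP => /US.
have [tau tau0 sep] := separating_step (0 :: U).
pose P (j : nat) := \sum_(v <- V) (Num.sg (lam v))%:C%C * cis (- v * tau) ^+ j.
pose T (j : nat) := \sum_(u <- U) (lam u)%:C%C * (cis (tau *+ j * u) - 1).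
pose H j := h (tau *+ j).
pose r j := expC (H j) - 1.
pose L j := \sum_(k < K) (-1) ^+ k / k.+1%:R * r j ^+ k.+1.
have sg1 v : `|Num.sg (lam v)| <= 1 by rewrite normr_sg; case: (lam v != 0).
have PV j : normc (P j) <= (size V)%:R.
  apply: le_trans (normc_sum _ _ _ _) _.
  rewrite -sum1_size natr_sum; apply: ler_sum => v _.
  by rewrite normcM normc_exp normc_cis expr1n mulr1 normc_real.
have P1 : mod_mean_le P 1.
  apply: mod_mean_le_characters => // u v uV' vV; apply: sep.
    by rewrite inE VU ?orbT.
  by rewrite inE VU ?orbT.
have rb : bounded_seq r.
  exists (1/4) => j; apply: le_trans (normc_expC_sub1_le _ _) _;
    have := h16 (tau *+ j); rewrite -/(H j); lra.
have LP : mean_le (fun j => L j * P j) (2 * d).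
  have -> : (fun j => L j * P j) =
      (fun j => \sum_(k < K) (-1) ^+ k / k.+1%:R * (r j ^+ k.+1 * P j)).
    by apply/funext => j; rewrite mulr_suml; apply: eq_bigr => k _; rewrite mulrA.
  apply: (mean_le_monotone _ (\sum_(k < K) d ^+ k.+1)); first exact: geometric_le.
  apply: mean_le_sum => k _.
  (* The logarithmic coefficient has modulus [1 / (k + 1) <= 1]. *)
  apply: (mean_le_monotone _ (normc ((-1) ^+ k / k.+1%:R) * d ^+ k.+1)).
    rewrite ler_piMl ?exprn_ge0// normcM normc_exp normc_opp normc1 expr1n mul1r.
    rewrite normcV normcMn normc1 invf_le1 ?ler1n//.
  apply: mean_le_scale.
  (* The frequency [0] turns the modulated bound into a plain mean. *)
  have := wiener_leX r d P 1 k.+1 rb (rd tau) (ex_intro _ _ PV) P1 0.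
  by rewrite cis0 mulr1; under eq_fun do rewrite expr1n mulr1.
have := mean_leD _ _ _ _ (mean_le_log_trig V U lam tau uV uU VU U0 sep) LP.
have HT : mean_le (fun j => (T j - H j) * P j) ((1/4) ^+ K * (size V)%:R).
  apply: mean_le_bounded => j; rewrite normcM ler_pM ?normc_ge0//.
  by rewrite -normc_opp opprB; exact: hUe.
have HL : mean_le (fun j => (H j - L j) * P j) ((1/4) ^+ K * (size V)%:R).
  apply: mean_le_bounded => j; rewrite normcM ler_pM ?normc_ge0//.
  rewrite -normc_opp opprB; apply: le_trans (log_series_approx _ _ (h16 _)) _.
  rewrite mulrA ler_piMl ?(ltW e0)//; have := h16 (tau *+ j); lra.
move=> /(mean_leD _ _ _ _ HT) /(mean_leD _ _ _ _ HL).
(* With [m] the mass on [V], the identity [m = (m - T P) + (T - H) P + (H - L) P + L P] turns the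
   four bounds into one on a constant sequence. *)
set q := (X in mean_le X); rewrite (_ : q = fun=> (\sum_(v <- V) `|lam v|)%:C%C).
  move=> /mean_le_const; rewrite normc_real; move/ler_normlW; lra.
by apply/funext => j; rewrite /q -/(T j) -/(P j); ring.
Qed.

End wiener_logarithm.

(** * Unordered sums *)

Section unordered_sums.
Context {R : realType}.
Implicit Types (S : set R) (U V W : seq R) (lam : R -> R).

Lemma esum_seq U (g : R -> R) : uniq U -> (forall u, 0 <= g u) ->
  (\esum_(u in [set` U]) (g u)%:E)%E = (\sum_(u <- U) g u)%:E.
Proof.
move=> uU g0; rewrite esum_fset; [|exact: finite_seq|by move=> u _; rewrite lee_fin].
by rewrite -fsbig_seq// sumEFin.
Qed.

Lemma seq_sum_le_esum S U (g : R -> R) : uniq U -> {in U, forall u, S u} ->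
  (forall u, 0 <= g u) ->
  ((\sum_(u <- U) g u)%:E <= \esum_(u in S) (g u)%:E)%E.
Proof.
move=> uU US g0; rewrite -esum_seq// [leRHS](esumID [set` U]); last first.
  by move=> u _; rewrite lee_fin.
rewrite setIidr; last by move=> u /=; exact: US.
by rewrite leeDl// esum_ge0// => u _; rewrite lee_fin.
Qed.

Lemma seq_sum_le V U (g : R -> R) : uniq V -> uniq U -> {subset V <= U} ->
  (forall u, 0 <= g u) -> \sum_(u <- V) g u <= \sum_(u <- U) g u.
Proof.
by move=> uV uU VU g0; rewrite -lee_fin -(esum_seq U)//; exact: seq_sum_le_esum.
Qed.

Lemma esum_le_seq S (g : R -> R) (B : R) : (forall u, 0 <= g u) ->
  (forall U, uniq U -> {in U, forall u, S u} -> \sum_(u <- U) g u <= B) ->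
  (\esum_(u in S) (g u)%:E <= B%:E)%E.
Proof.
move=> g0 gB; apply: ge_ereal_sup => _ [A [finA AS] <-].
rewrite fsbig_finite//= sumEFin lee_fin; apply: gB => [|u].
  exact: fset_uniq.
by rewrite in_fset_set// inE => /AS.
Qed.

(** A finite set carrying the mass of [lam] up to [e] serves every [g] dominated by [2 |lam|] at
    once; this makes later approximations uniform in [t]. The [2] is the bound on [|cis x - 1|]. *)
Lemma summable_tail S lam W (e : R) : summable S (EFin \o lam) -> 0 < e ->
  {in W, forall u, S u} -> exists U : seq R,
  [/\ uniq U, {subset W <= U}, {in U, forall u, S u} &
   forall g : R -> R, (forall u, 0 <= g u <= 2 * `|lam u|) ->
     exists2 x : R, 0 <= x <= 2 * e &
       (\esum_(u in S) (g u)%:E)%E = (\sum_(u <- U) g u + x)%:E].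
Proof.
move=> sS e0 WS.
have sfin : (\esum_(u in S) `|lam u|%:E)%E \is a fin_num by move: sS; rewrite summableE.
have [_ [A [finA AS] <-] Ae] := ub_ereal_sup_adherent e0 sfin.
have [M ME] : exists M : R, (\esum_(u in S) `|lam u|%:E)%E = M%:E.
  by exists (fine (\esum_(u in S) `|lam u|%:E)); rewrite fineK.
rewrite -/(esum _ _) ME fsbig_finite//= sumEFin lte_fin in Ae.
have leM V : uniq V -> {in V, forall u, S u} -> \sum_(u <- V) `|lam u| <= M.
  move=> uV VS; rewrite -lee_fin -ME.
  exact: (seq_sum_le_esum S V (fun u => `|lam u|)).
pose U := undup (fset_set A ++ W).
have uU : uniq U by exact: undup_uniq.
have US : {in U, forall u, S u}.
  move=> u; rewrite mem_undup mem_cat in_fset_set// => /orP[/set_mem/AS//|/WS//].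
have UM : M - e < \sum_(u <- U) `|lam u|.
  apply: lt_le_trans Ae _; apply: seq_sum_le => //; first exact: fset_uniq.
  move=> u uA.
  by rewrite mem_undup mem_cat uA.
exists U; split => //.
  by move=> u uW; rewrite mem_undup mem_cat uW orbT.
move=> g glam; have g0 u : 0 <= g u by case/andP: (glam u).
have lb := seq_sum_le_esum S U g uU US g0.
have ub : (\esum_(u in S) (g u)%:E <= (\sum_(u <- U) g u + 2 * e)%:E)%E.
  apply: esum_le_seq => // V uV VS.
  rewrite (bigID (mem U))/=; apply: lerD.
    rewrite -big_filter; apply: seq_sum_le => //; first exact: filter_uniq.
    by move=> u; rewrite mem_filter => /andP[].
  (* [U] together with the part of [V] outside it has mass at most [M], while [U] alone exceeds
     [M - e]. *)
  apply: (@le_trans _ _ (2 * \sum_(u <- V | u \notin U) `|lam u|)).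
    by rewrite mulr_sumr; apply: ler_sum => u _; case/andP: (glam u).
  rewrite ler_wpM2l// -big_filter.
  have := leM (U ++ [seq u <- V | u \notin U]); rewrite big_cat/=.
  suff uUV : uniq (U ++ [seq u <- V | u \notin U]).
    move=> /(_ uUV); set x := \sum_(i <- [seq u <- V | u \notin U]) `|lam i| => H.
    suff : \sum_(i <- U) `|lam i| + x <= M by lra.
    by apply: H => u; rewrite mem_cat mem_filter => /orP[/US//|/andP[_ /VS]].
  rewrite cat_uniq uU filter_uniq// andbT /=.
  by apply/hasPn => u; rewrite mem_filter => /andP[].
move: lb ub; case: (esum _ _) => [y||]//; rewrite !lee_fin => lb ub.
exists (y - \sum_(u <- U) g u); last by congr EFin; ring.
by apply/andP; split; lra.
Qed.

(** The remainders of the positive and the negative part both lie in [[0, e]], hence so does the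
    modulus of their difference. *)
Lemma Rsum_approx S lam W (e : R) : summable S (EFin \o lam) -> 0 < e ->
  {in W, forall u, S u} -> exists U : seq R,
  [/\ uniq U, {subset W <= U}, {in U, forall u, S u} &
   forall f : R -> R, (forall u, `|f u| <= 2 * `|lam u|) ->
     `|Rsum S f - \sum_(u <- U) f u| <= e].
Proof.
move=> sS e0 WS; have e20 : 0 < e / 2 by lra.
have [U [uU WU US HU]] := summable_tail S lam W (e / 2) sS e20 WS.
exists U; split => // f flam; rewrite /Rsum funerpos funerneg.
have [x x01 ->] : exists2 x : R, 0 <= x <= 2 * (e / 2) &
   esum S (EFin \o f^\+) = (\sum_(u <- U) f^\+ u + x)%:E.
  apply: HU => u; rewrite /funrpos le_max lexx orbT/= ge_max mulr_ge0// andbT.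
  exact: le_trans (ler_norm _) (flam u).
have [y y01 ->] : exists2 x : R, 0 <= x <= 2 * (e / 2) &
   esum S (EFin \o f^\-) = (\sum_(u <- U) f^\- u + x)%:E.
  apply: HU => u; rewrite /funrneg le_max lexx orbT/= ge_max mulr_ge0// andbT.
  by rewrite (le_trans (ler_norm _))// normrN.
rewrite /= [\sum_(u <- U) f u](_ : _ = \sum_(u <- U) f^\+ u - \sum_(u <- U) f^\- u).
  by rewrite ler_norml; apply/andP; split; lra.
rewrite -sumrB; apply: eq_bigr => u _.
by rewrite -[in LHS](funrposBneg f).
Qed.

Lemma Csum_approx S lam W (e : R) : summable S (EFin \o lam) -> 0 < e ->
  {in W, forall u, S u} -> exists U : seq R,
  [/\ uniq U, {subset W <= U}, {in U, forall u, S u} &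
   forall f : R -> R[i], (forall u, normc (f u) <= 2 * `|lam u|) ->
     normc (Csum S f - \sum_(u <- U) f u) <= e].
Proof.
move=> sS e0 WS; have e20 : 0 < e / 2 by lra.
have [U [uU WU US HU]] := Rsum_approx S lam W (e / 2) sS e20 WS.
exists U; split => // f flam; apply: le_trans (normc_Re_Im _) _.
rewrite [e]splitr; apply: lerD; rewrite raddfB/= raddf_sum; apply: HU => u;
  by apply: le_trans (flam u); rewrite ?Re_normc ?Im_normc.
Qed.

End unordered_sums.

(** * Spectral representations close to a character *)

Section spectral_bounds.
Context {R : realType}.
Implicit Types (t u gam : R) (lam : R -> R) (U : seq R).

Lemma normc_mulc_cis_sub1 (a x : R) : normc (a%:C%C * (cis x - 1)) <= 2 * `|a|.
Proof.
rewrite normcM normc_real mulrC ler_wpM2r//.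
by apply: le_trans (normcB_le _ _) _; rewrite normc_cis normc1.
Qed.

(* [|h|] takes no value in [`]1/64, 1/16]], and [h 0 = 0]. *)
Lemma normc_le_of_expC_sub1 (h : R -> R[i]) :
  h 0 = 0 ->
  (forall e : R, 0 < e -> exists2 g : R -> R[i],
     forall t, normc (h t - g t) <= e & continuous (fun t => normc (g t))) ->
  (forall t, normc (expC (h t) - 1) <= 1/128) ->
  forall t, normc (h t) <= 1/16.
Proof.
move=> h0 hg he t0; rewrite leNgt; apply/negP => ht0.
(* [|h t| <= 2 |expC (h t) - 1| <= 2/128]. *)
have small t : normc (h t) <= 1/16 -> normc (h t) <= 1/64.
  by move=> /normc_le_expC_sub1; have := he t; lra.
have [g hge gc] := hg (1/128) ltac:(lra).
have gh t : normc (g t) <= normc (h t) + 1/128.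
  by have := hge t; have := normc_triangle_sub (g t) (h t);
    rewrite -(normc_opp (g t - _)) opprB; lra.
have hgt t : normc (h t) <= normc (g t) + 1/128.
  by have := hge t; have := normc_triangle_sub (h t) (g t); lra.
pose k s := normc (g (s * t0)).
(* [h] is only a uniform limit, so the intermediate value is taken for [|g|]. Where [|g| = 1/32],
   [|h|] lies between [3/128] and [5/128], inside the forbidden gap. *)
have [|||s _ ks] := @IVT R k 0 1 (1/32).
- by [].
- apply: continuous_subspaceT => s; rewrite /k.
  have -> : (fun s => normc (g (s * t0))) = (fun t => normc (g t)) \o *%R^~ t0 by [].
  by apply: continuous_comp; [exact: mulrr_continuous|exact: gc].
- have k0 : k 0 <= 1/128.
    by rewrite /k (mul0r t0); have := gh 0; rewrite h0 normc0 add0r.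
  have k1 : 1/32 <= k 1 by rewrite /k (mul1r t0); have := hgt t0; lra.
  by rewrite ge_min le_max; apply/andP; split; apply/orP; [left|right]; lra.
have := gh (s * t0); have := hgt (s * t0); rewrite -/(k s) ks => h1 h2.
by have := small (s * t0) ltac:(lra); lra.
Qed.

Lemma continuous_normc_of_cderive (g : R -> R[i]) :
  (forall t, exists l, is_cderive g t l) -> continuous (fun t => normc (g t)).
Proof.
move=> gd.
have -> : (fun t => normc (g t)) = Num.sqrt \o
    ((fun t => complex.Re (g t)) * (fun t => complex.Re (g t)) +
     (fun t => complex.Im (g t)) * (fun t => complex.Im (g t))).
  apply/funext => t; rewrite -[RHS]/(Num.sqrt (complex.Re (g t) * complex.Re (g t) +
    complex.Im (g t) * complex.Im (g t))).
  by case: (g t) => a b; rewrite /= !expr2.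
have cr : continuous (fun t => complex.Re (g t)).
  move=> t; have [l [[dr _] _]] := gd t.
  by apply: differentiable_continuous; exact/derivable1_diffP.
have ci : continuous (fun t => complex.Im (g t)).
  move=> t; have [l [_ [di _]]] := gd t.
  by apply: differentiable_continuous; exact/derivable1_diffP.
move=> t; apply: continuous_comp; last exact: sqrt_continuous.
by apply: cvgD; apply: cvgM; [exact: cr|exact: cr|exact: ci|exact: ci].
Qed.

Lemma is_cderive_cis u t : exists l, is_cderive (fun t => cis (t * u)) t l.
Proof.
exists ('i * u%:C%C * expC (t%:C%C * ('i * u%:C%C))).
have -> : (fun t => cis (t * u)) = (fun t => expC (t%:C%C * ('i * u%:C%C))).
  by apply/funext => s; rewrite mulrCA -rmorphM/= expC_i.
exact: is_cderive_exp.
Qed.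

Lemma continuous_normc_trig gam lam U :
  continuous (fun t => normc ('i * (t * gam)%:C%C +
    \sum_(u <- U) (lam u)%:C%C * (cis (t * u) - 1))).
Proof.
apply: (continuous_normc_of_cderive (fun t => _ + _)) => t.
suff [l dl] : exists l, is_cderive
    (fun t => \sum_(u <- U) (lam u)%:C%C * (cis (t * u) - 1)) t l.
  exists ('i * gam%:C%C + l); apply: is_cderiveD => //.
  rewrite (_ : (fun t => _) = (fun t => t%:C%C * ('i * gam%:C%C))).
    exact: is_cderive_lin.
  by apply/funext => s; rewrite rmorphM/=; ring.
elim: U => [|u U [l IH]].
  exists 0; under eq_fun do rewrite big_nil.
  exact: is_cderive_cst.
have [m dm] := is_cderive_cis u t.
eexists; under eq_fun do rewrite big_cons.
apply: is_cderiveD IH; apply: is_cderiveM; first exact: is_cderive_cst.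
apply: is_cderiveD dm _; exact: is_cderive_cst.
Qed.

(** Closeness of [f] to [1] keeps the exponent [h] small, which forces [gam = 0]; the exponent is
    then a pure series, as [wiener_log_bound] requires. The threshold [1/128] is that of
    [normc_le_of_expC_sub1]. *)
Lemma spectral_bound (S : set R) lam gam (d : R) :
  ~ S 0 -> summable S (EFin \o lam) -> 0 <= d -> d <= 1/128 ->
  let f t := expC ('i * (t * gam)%:C%C +
     Csum S (fun u => (lam u)%:C%C * (cis (t * u) - 1))) in
  (forall t, normc (f t - 1) <= d) ->
  (forall tau, wiener_le (fun j => f (tau *+ j) - 1) d) ->
  (\esum_(u in S) `|lam u|%:E <= (2 * d)%:E)%E.
Proof.
move=> S0 sS d0 d128 f fd fw.
pose h t := 'i * (t * gam)%:C%C +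
  Csum S (fun u => (lam u)%:C%C * (cis (t * u) - 1)).
have happ (W : seq R) (e : R) : 0 < e -> {in W, forall u, S u} -> exists U : seq R,
    [/\ uniq U, {subset W <= U}, {in U, forall u, S u} &
    forall t, normc (h t - ('i * (t * gam)%:C%C +
      \sum_(u <- U) (lam u)%:C%C * (cis (t * u) - 1))) <= e].
  move=> e0 WS; have [U [uU WU US HU]] := Csum_approx S lam W e sS e0 WS.
  exists U; split => // t; rewrite /h [X in X - _]addrC addrKA.
  by apply: HU => u; exact: normc_mulc_cis_sub1.
have h16 : forall t, normc (h t) <= 1/16.
  apply: normc_le_of_expC_sub1.
  (* The finite approximants vanish at [0], and [h 0] is within every [e] of one of them. *)
  - apply: eq0_normc; apply/eqP; rewrite eq_le normc_ge0 andbT.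
    apply/ler_addgt0Pr => e e0; rewrite add0r.
    have [U [_ _ _ /(_ 0)]] := happ [::] e e0 ltac:(by []).
    rewrite mul0r mulr0 add0r big1 ?subr0// => u _.
    by rewrite mul0r cis0 subrr mulr0.
  - move=> e e0; have [U [_ _ _ hU]] := happ [::] e e0 ltac:(by []).
    by eexists; [exact: hU|exact: continuous_normc_trig].
  - by move=> t; apply: le_trans (fd t) _.
(* [h] is bounded, as is its series part, hence so is [t * gam]. *)
have gam0 : gam = 0.
  apply/eqP; apply: contraT => gam0.
  have [U [_ _ _ hU]] := happ [::] 1 ltr01 ltac:(by []).
  pose C := \sum_(u <- U) 2 * `|lam u|.
  have C0 : 0 <= C by apply: sumr_ge0 => u _; rewrite mulr_ge0.
  have bound t : `|t * gam| <= 1/16 + 1 + C.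
    have i1 : normc ('i : R[i]) = 1 by rewrite /= expr0n/= add0r expr1n sqrtr1.
    have -> : `|t * gam| = normc ('i * (t * gam)%:C%C).
      by rewrite normcM i1 mul1r normc_real.
    set s := \sum_(u <- U) (lam u)%:C%C * (cis (t * u) - 1).
    have -> : 'i * (t * gam)%:C%C = h t - (h t - ('i * (t * gam)%:C%C + s)) - s by ring.
    apply: le_trans (normcB_le _ _) _; apply: lerD.
      by apply: le_trans (normcB_le _ _) _; apply: lerD; [exact: h16|exact: hU].
    apply: le_trans (normc_sum _ _ _ _) _; apply: ler_sum => u _.
    exact: normc_mulc_cis_sub1.
  (* This [t] makes [t * gam] exceed the bound by [1]. *)
  have := bound ((1/16 + 1 + C + 1) / gam); rewrite divfK// ger0_norm; lra.
apply: esum_le_seq => // V uV VS.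
apply: (wiener_log_bound S lam h) => //; last by lra.
move=> W e e0 WS; have [U [uU WU US hU]] := happ W e e0 WS.
exists U; split => // t; have := hU t.
by rewrite gam0 mulr0 (_ : 0%:C%C = 0)// mulr0 add0r.
Qed.

End spectral_bounds.

(** * Discrete distribution functions *)

Section discrete_distributions.
Context {R : realType}.
Implicit Types (F : distribution_function R) (x p : nat -> R).

(** The tail of [g] is at most [C] times the tail of [p], and the latter is the mass missing from
    the first [n] weights. *)
Lemma nneseries_trunc (p g : nat -> R) (C : R) n :
  (forall k, 0 <= p k) -> (\sum_(k <oo) (p k)%:E = 1)%E ->
  0 <= C -> (forall k, 0 <= g k <= C * p k) ->
  exists2 v : R, (\sum_(k <oo) (g k)%:E = v%:E)%E &
    \sum_(k < n) g k <= v <= \sum_(k < n) g k + C * (1 - \sum_(k < n) p k).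
Proof.
move=> p0 p1 C0 gp; have g0 k : 0 <= g k by case/andP: (gp k).
have lb : ((\sum_(k < n) g k)%:E <= \sum_(k <oo) (g k)%:E)%E.
  rewrite -sumEFin -(big_mkord xpredT (fun k => (g k)%:E)).
  by apply: nneseries_lim_ge => k _ _; rewrite lee_fin.
have pn m : \sum_(k < m) p k <= 1.
  rewrite -lee_fin -p1 -sumEFin -(big_mkord xpredT (fun k => (p k)%:E)).
  by apply: nneseries_lim_ge => k _ _; rewrite lee_fin.
have ub : (\sum_(k <oo) (g k)%:E <=
    (\sum_(k < n) g k + C * (1 - \sum_(k < n) p k))%:E)%E.
  apply: lime_le; first by apply: is_cvg_nneseries => k _ _; rewrite lee_fin.
  near=> m; rewrite big_mkord sumEFin lee_fin.
  have /subnKC <- : (n <= m)%N by near: m; exact: nbhs_infty_ge.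
  have := pn (n + (m - n))%N.
  rewrite !big_split_ord/= => pnm; rewrite lerD2l.
  apply: (@le_trans _ _ (C * \sum_(i < m - n) p (n + i)%N)).
    by rewrite mulr_sumr; apply: ler_sum => i _; case/andP: (gp (n + i)%N).
  by rewrite ler_wpM2l//; lra.
move: lb ub; case: (limn _) => [v||]//; rewrite !lee_fin => lb ub.
by exists v; rewrite ?lb.
Unshelve. all: end_near. Qed.

Lemma discrete_rep_tail F x p (e : R) : discrete_rep F x p -> 0 < e ->
  exists m, forall n, (m <= n)%N -> 1 - e <= \sum_(k < n) p k <= 1.
Proof.
move=> [_ p0 p1 _] e0.
have pn n : \sum_(k < n) p k <= 1.
  rewrite -lee_fin -p1 -sumEFin -(big_mkord xpredT (fun k => (p k)%:E)).
  by apply: nneseries_lim_ge => k _ _; rewrite lee_fin.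
have [m hm] : exists m, 1 - e < \sum_(k < m) p k.
  apply: contrapT => /forallNP np.
  have : (\sum_(k <oo) (p k)%:E <= (1 - e)%:E)%E.
    apply: lime_le; first by apply: is_cvg_nneseries => k _ _; rewrite lee_fin.
    apply: nearW => n; rewrite big_mkord sumEFin lee_fin leNgt.
    by apply/negP; exact: np.
  by rewrite p1 lee_fin; lra.
exists m => n mn; rewrite pn andbT; apply: le_trans (ltW hm) _.
by rewrite -(subnKC mn) big_split_ord/= lerDl; apply: sumr_ge0 => k _.
Qed.

(** The Stieltjes measure of [F] and the sum of point masses [p k] at [x k] agree on the intervals
    []a, b]], hence on all measurable sets. *)
Lemma integral_discrete F x p (f : R -> R) : discrete_rep F x p ->
  measurable_fun setT (f : measurableTypeR R -> R) -> (forall y, 0 <= f y) ->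
  (\int[lebesgue_stieltjes_measure F]_y (f y)%:E =
   \sum_(k <oo) (p k * f (x k))%:E)%E.
Proof.
move=> [xi p0 p1 Fx] mf f0.
pose m_ k := mscale (NngNum (p0 k)) (@dirac _ (measurableTypeR R) (x k) R).
have E (A : set (measurableTypeR R)) : measurable A ->
    lebesgue_stieltjes_measure F A = mseries m_ 0 A.
  apply: lebesgue_stieltjes_measure_unique => _ [[a b] _ <-]/=.
  rewrite /lebesgue_stieltjes_measure.
  rewrite /measure_extension measurable_mu_extE/=; last exact: is_ocitv.
  have mE B : mseries m_ 0 B = (\sum_(k <oo) (p k * \1_B (x k))%:E)%E.
    by apply: eq_eseriesr => k _; rewrite /m_ /mscale /dirac/= EFinM.
  rewrite mE; have [ab|ba] := ltP a b; last first.
    rewrite set_itv_ge ?bnd_simp -?leNgt// wlength0 eseries0// => k _ _.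
    by rewrite indicE in_set0 mulr0.
  rewrite wlength_itv_bnd ?(ltW ab)// EFinB !Fx.
  have -> : (\sum_(k <oo) (p k * \1_`[x k, +oo[ b)%:E =
    \sum_(k <oo) (p k * \1_`[x k, +oo[ a)%:E +
    \sum_(k <oo) (p k * \1_`]a, b] (x k))%:E)%E.
    rewrite -nneseriesD; [|by move=> k _; rewrite lee_fin mulr_ge0|
      by move=> k _; rewrite lee_fin mulr_ge0].
    apply: eq_eseriesr => k _; rewrite -EFinD -mulrDr; congr (_ * _)%:E.
    have Iray c : (c \in `[x k, +oo[%classic) = (x k <= c).
      by rewrite mem_setE in_itv/= andbT.
    rewrite !indicE !Iray mem_setE in_itv/=.
    have [xa|xa] := leP (x k) a; first by rewrite (le_trans xa (ltW ab)) addr0.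
    by rewrite add0r.
  by rewrite -Fx addeAC subee ?add0e.
rewrite (eq_measure_integral (mseries m_ 0)); last by move=> A mA _; exact: E.
rewrite ge0_integral_measure_series//; first last.
- exact/measurable_EFinP.
- by move=> y _; rewrite lee_fin.
apply: eq_eseriesr => k _.
rewrite ge0_integral_mscale//; first last.
- by move=> y _; rewrite lee_fin.
- exact/measurable_EFinP.
rewrite integral_dirac//; last exact/measurable_EFinP.
by rewrite diracE mem_setT mul1e.
Qed.

Lemma lebesgue_stieltjes_setT F x p : discrete_rep F x p ->
  lebesgue_stieltjes_measure F setT = 1%E.
Proof.
move=> rF; have [xi p0 p1 Fx] := rF.
have := @integral_discrete F x p (cst 1) rF (measurable_cst _) (fun=> ler01).
rewrite /= integral_cst//= mul1e => ->.
by rewrite -p1; apply: eq_eseriesr => k _; rewrite mulr1.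
Qed.

(** Shifting to [1 + f], with values in [[0, 2]], makes the nonnegative case applicable; its
    one-sided error of twice the missing mass becomes symmetric when the shift is undone. *)
Lemma Rintegral_discrete_trunc F x p (f : R -> R) n : discrete_rep F x p ->
  measurable_fun setT (f : measurableTypeR R -> R) -> (forall y, `|f y| <= 1) ->
  `|\int[lebesgue_stieltjes_measure F]_y f y - \sum_(k < n) p k * f (x k)|
    <= 1 - \sum_(k < n) p k.
Proof.
move=> rF mf f1; have [xi p0 p1 Fx] := rF.
have f11 y : -1 <= f y <= 1 by rewrite -ler_norml.
have muT := lebesgue_stieltjes_setT F x p rF.
have g2 k : 0 <= p k * (1 + f (x k)) <= 2 * p k.
  have /andP[h1 h2] := f11 (x k).
  by rewrite mulr_ge0 ?p0//=; [rewrite mulrC ler_wpM2r ?p0//; lra|lra].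
have [v vE vn] := nneseries_trunc p (fun k => p k * (1 + f (x k))) 2 n p0 p1 ltac:(by []) g2.
have m1f : measurable_fun setT ((fun y => 1 + f y) : measurableTypeR R -> R).
  by apply: measurable_funD => //; exact: measurable_cst.
have I1f : \int[lebesgue_stieltjes_measure F]_y (1 + f y) = v.
  rewrite /Rintegral (integral_discrete F x p)// ?vE// => y.
  by have /andP[h1 h2] := f11 y; lra.
move: I1f; rewrite RintegralD//; last 2 first.
- apply: measurable_bounded_integrable => //.
  + by rewrite /= muT ltry.
  + by exists 1; split => // M M1 y _ /=; rewrite normr1 ltW.
- apply: measurable_bounded_integrable => //.
  + by rewrite /= muT ltry.
  + by exists 1; split => // M M1 y _ /=; rewrite (le_trans (f1 _))// ltW.
rewrite Rintegral_cst// [fine _](_ : _ = 1) ?mulr1; last by rewrite /= muT.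
move=> I1f; move: vn.
have -> : \sum_(k < n) p k * (1 + f (x k)) = \sum_(k < n) p k + \sum_(k < n) p k * f (x k).
  by rewrite -big_split/=; apply: eq_bigr => k _; rewrite mulrDr mulr1.
move=> /andP[h1 h2]; set I := Rintegral _ _ _ in I1f *.
by rewrite ler_norml; apply/andP; clearbody I; clear -h1 h2 I1f; split; lra.
Qed.

Lemma char_fun_trunc F x p t n : discrete_rep F x p ->
  normc (char_fun F t - \sum_(k < n) (p k)%:C%C * cis (t * x k))
    <= 2 * (1 - \sum_(k < n) p k).
Proof.
move=> rF; apply: le_trans (normc_Re_Im _) _; rewrite mulr_natl mulr2n.
rewrite /char_fun; under [X in Cintegral _ _ X]eq_fun do rewrite expC_i.
have mt : measurable_fun setT ((fun y => t * y) : measurableTypeR R -> R).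
  by apply: continuous_measurable_fun; exact: mulrl_continuous.
set S := \sum_(k < n) _.
have ReS : complex.Re S = \sum_(k < n) p k * cos (t * x k).
  by rewrite raddf_sum; apply: eq_bigr => k _; rewrite /cis; simpc.
have ImS : complex.Im S = \sum_(k < n) p k * sin (t * x k).
  by rewrite raddf_sum; apply: eq_bigr => k _; rewrite /cis; simpc.
rewrite !raddfB/= ReS ImS; apply: lerD.
- apply: (Rintegral_discrete_trunc F x p (fun y => cos (t * y)) n rF).
  + apply: measurableT_comp mt.
    by apply: continuous_measurable_fun; exact: continuous_cos.
  + by move=> y; rewrite ler_norml cos_geN1 cos_le1.
- apply: (Rintegral_discrete_trunc F x p (fun y => sin (t * y)) n rF).
  + apply: measurableT_comp mt.
    by apply: continuous_measurable_fun; exact: continuous_sin.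
  + by move=> y; rewrite ler_norml sin_geN1 sin_le1.
Qed.

Lemma cdf_trunc F x p y n : discrete_rep F x p ->
  \sum_(j < n) p j * (x j <= y)%R%:R <= F y
    <= \sum_(j < n) p j * (x j <= y)%R%:R + (1 - \sum_(j < n) p j).
Proof.
move=> [xi p0 p1 Fx].
have Iray j : \1_(`[x j, +oo[) y = (x j <= y)%R%:R :> R.
  by rewrite indicE mem_setE in_itv/= andbT.
have pI j : 0 <= p j * (x j <= y)%R%:R <= 1 * p j.
  by rewrite mul1r mulr_ge0 ?p0//= ler_piMr ?p0// lern1 leq_b1.
have [v vE] := nneseries_trunc p _ 1 n p0 p1 ler01 pI.
have -> : F y = v.
  by apply: EFin_inj; rewrite Fx -vE; apply: eq_eseriesr => j _; rewrite Iray.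
by rewrite mul1r.
Qed.

(** Each atom in []x k - e, x k]] adds a nonnegative amount to the increment, and truncation costs
    an arbitrarily small [d]. *)
Lemma discrete_jump_ge F x p k (e : R) : discrete_rep F x p -> 0 < e ->
  p k <= F (x k) - F (x k - e).
Proof.
move=> rF e0; have [xi p0 p1 Fx] := rF.
apply/ler_addgt0Pr => d d0.
have [m hm] := discrete_rep_tail F x p d rF d0.
pose n := maxn m k.+1.
have /andP[t1 _] := hm n (leq_maxl _ _).
have kn : (k < n)%N by rewrite leq_max ltnSn orbT.
have /andP[b1 _] := cdf_trunc F x p (x k) n rF.
have /andP[_ b2] := cdf_trunc F x p (x k - e) n rF.
have : p k <= \sum_(j < n) p j * (x j <= x k)%R%:R -
              \sum_(j < n) p j * (x j <= x k - e)%R%:R.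
  rewrite -sumrB (bigD1 (Ordinal kn))//= lexx.
  rewrite (_ : (x k <= x k - e) = false); last by apply/negP; lra.
  rewrite mulr1 mulr0 subr0 lerDl; apply: sumr_ge0 => j _.
  rewrite -mulrBr mulr_ge0 ?p0// subr_ge0 ler_nat.
  by case: (leP (x j) (x k - e)) => // h; rewrite (_ : x j <= x k)//; lra.
lra.
Qed.

(** Finitely many atoms carry all mass but [e1]. For [e] small none of them lies in []a - e, a[], so
    an atom at [a] must account for the jump up to [e1]. *)
Lemma discrete_jump_atom F x p (a c d : R) : discrete_rep F x p ->
  (forall e, 0 < e -> c <= F a - F (a - e)) -> d < c -> 0 <= d ->
  exists2 k, x k = a & d <= p k.
Proof.
move=> rF Fc dc d0; have [xi p0 p1 Fx] := rF.
pose e1 := (c - d) / 2.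
have e10 : 0 < e1 by rewrite /e1; lra.
have [n /(_ n (leqnn n))/andP[t1 _]] := discrete_rep_tail F x p e1 rF e10.
have [e e0 sep] : exists2 e : R, 0 < e & forall j, (j < n)%N -> x j < a -> x j <= a - e.
  elim: {t1} n => [|n [e e0 IH]]; first by exists 1.
  have [xa|xa] := ltP (x n) a; last first.
    exists e => // j; rewrite ltnS leq_eqVlt => /predU1P[->|/IH//].
    by rewrite ltNge xa.
  exists (Num.min e (a - x n)); first by rewrite lt_min e0 subr_gt0.
  move=> j; rewrite ltnS leq_eqVlt => /predU1P[-> _|/IH/[apply] h].
    by rewrite lerBrDr -lerBrDl ge_min lexx orbT.
  by rewrite (le_trans h)// lerD2l lerN2 ge_min lexx.
have /andP[_ b1] := cdf_trunc F x p a n rF.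
have /andP[b2 _] := cdf_trunc F x p (a - e) n rF.
have jump : c <= \sum_(j < n) p j * (x j == a)%:R + e1.
  have -> : \sum_(j < n) p j * (x j == a)%:R = \sum_(j < n) p j * (x j <= a)%R%:R -
     \sum_(j < n) p j * (x j <= a - e)%R%:R.
    rewrite -sumrB; apply: eq_bigr => j _; rewrite -mulrBr; congr (_ * _).
    case: (ltgtP (x j) a) => xa.
    - by rewrite sep// subrr.
    - by rewrite (_ : (x j <= a - e) = false) ?subrr//; apply/negP; lra.
    - by rewrite (_ : (x j <= a - e) = false) ?subr0//; apply/negP; lra.
  by have := Fc e e0; lra.
(* Without such an atom, [c <= e1 = (c - d) / 2], against [0 <= d < c]. *)
have [[k xk]|nk] := pselect (exists k : 'I_n, x k = a); last first.
  move: jump; rewrite big1 => [|j _]; first by rewrite /e1; lra.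
  by case: eqP => xj; [case: nk; exists j|rewrite mulr0].
exists k => //; move: jump; rewrite (bigD1 k)//= xk eqxx mulr1 big1 ?addr0.
  by rewrite /e1; lra.
move=> j jk; rewrite -xk (inj_eq xi) (negbTE (_ : _ != _)) ?mulr0//.
Qed.

End discrete_distributions.

(** * Compactness in variation *)

Section compactness.
Context {R : realType}.
Implicit Types (F G : distribution_function R) (x p : nat -> R).

(** Recentring at [x k] turns the main term into the constant [p k]. Subtracting [1] leaves the mass
    [1 - p k] there and at most [1 - p k] on the other atoms. *)
Lemma atom_approx F x p k (d e : R) : discrete_rep F x p -> 1 - d <= p k -> 0 < e ->
  exists (s : seq nat) (c : nat -> R[i]), \sum_(j <- s) normc (c j) <= 2 * d /\
  forall t, normc (char_fun F t * cis (- (t * x k)) - 1 -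
                   \sum_(j <- s) c j * cis (t * (x j - x k))) <= e.
Proof.
move=> rF dk e0; have [_ p0 _ _] := rF.
have [m hm] := discrete_rep_tail F x p (e / 2) rF ltac:(lra).
pose n := maxn m k.+1.
have /andP[t1 pn] := hm n (leq_maxl _ _).
have kn : (k < n)%N by rewrite leq_max ltnSn orbT.
exists (iota 0 n), (fun j => (p j)%:C%C - (j == k)%:R).
have iotaE (V : nmodType) (g : nat -> V) : \sum_(j <- iota 0 n) g j = \sum_(j < n) g j.
  by rewrite -(big_mkord xpredT g) /index_iota subn0.
rewrite !iotaE; split.
  rewrite (bigD1 (Ordinal kn))//= eqxx.
  have pk1 : p k <= 1.
    apply: le_trans pn; rewrite (bigD1 (Ordinal kn))//= lerDl.
    by apply: sumr_ge0 => j _.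
  have -> : (p k)%:C%C - true%:R = (p k - 1)%:C%C by rewrite rmorphB rmorph1.
  rewrite normc_real distrC ger0_norm ?subr_ge0//.
  rewrite (eq_bigr (fun j : 'I_n => p j)) => [|j jk]; last first.
    by rewrite (negbTE (_ : _ != _)) ?subr0 ?normc_real ?ger0_norm.
  by move: pn; rewrite (bigD1 (Ordinal kn))//=; lra.
move=> t; rewrite iotaE.
have -> : \sum_(j < n) ((p j)%:C%C - (j == k :> nat)%:R) * cis (t * (x j - x k)) =
    (\sum_(j < n) (p j)%:C%C * cis (t * x j)) * cis (- (t * x k)) - 1.
  rewrite mulr_suml [in RHS](eq_bigr (fun j : 'I_n => (p j)%:C%C * cis (t * (x j - x k)))).
    rewrite (bigD1 (Ordinal kn))//= [in RHS](bigD1 (Ordinal kn))//= eqxx subrr mulr0 cis0 !mulr1.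
    rewrite addrAC; congr (_ + _ - _); apply: eq_bigr => j jk.
    by rewrite (negbTE (_ : _ != _)) ?subr0.
  by move=> j _; rewrite -mulrA -cisD mulrBr.
rewrite opprB addrA subrK -mulrBl normcM normc_cis mulr1.
by apply: le_trans (char_fun_trunc F x p t n rF) _; lra.
Qed.

(** Multiplication by [cis (- (t * x k))] changes only the drift, not [lam]. By [atom_approx] the
    coefficient mass is [2 d], and [spectral_bound] doubles it; [1/256] is half of its threshold. *)
Lemma spectral_esum_le F gam lam x p k (d : R) :
  spectral_rep F gam lam -> discrete_rep F x p -> 1 - d <= p k ->
  0 <= d -> d <= 1/256 ->
  (\esum_(u in spectral_support F) `|lam u|%:E <= (4 * d)%:E)%E.
Proof.
move=> [_ sS cF] rF dk d0 d256.
pose f t := expC ('i * (t * (gam - x k))%:C%C +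
  Csum (spectral_support F) (fun u => (lam u)%:C%C * (cis (t * u) - 1))).
have fE t : f t = char_fun F t * cis (- (t * x k)).
  rewrite cF; under [X in Csum _ X]eq_fun do rewrite expC_i.
  rewrite -expC_i -expCD /f; congr expC.
  by rewrite rmorphN/= mulrBr rmorphB/=; ring.
have -> : 4 * d = 2 * (2 * d) by ring.
apply: (spectral_bound _ lam (gam - x k)) => //; [by case=> _; apply|lra|lra| |].
- move=> t; rewrite -/(f t) fE; apply/ler_addgt0Pr => e e0.
  have [s [c [sc /(_ t)]]] := atom_approx F x p k d e rF dk e0.
  set z := _ - 1; set w := \sum_(j <- s) _ => h.
  have : normc w <= 2 * d.
    apply: le_trans (normc_sum _ _ _ _) (le_trans _ sc); apply: ler_sum => j _.
    by rewrite normcM normc_cis mulr1.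
  by have := normc_triangle_sub z w; lra.
- move=> tau; apply: wiener_le_trig => e e0.
  have [s [c [sc hc]]] := atom_approx F x p k d e rF dk e0.
  exists s, c, (fun j => tau * (x j - x k)); split => // i.
  have := hc (tau *+ i); rewrite -fE -/(f _); congr (normc (_ - _) <= _).
  by apply: eq_bigr => j _; rewrite -cisMn mulrnAl.
Qed.

(** The drift is purely imaginary, so with [z] the series the modulus is
    [exp (Re z) >= 1 + Re z >= 1 - |z|]. *)
Lemma normc_char_fun_ge F gam lam t (s : R) : spectral_rep F gam lam ->
  (\esum_(u in spectral_support F) `|lam u|%:E <= s%:E)%E ->
  1 - 2 * s <= normc (char_fun F t).
Proof.
move=> [_ sS cF] lams; rewrite cF.
under [X in Csum _ X]eq_fun do rewrite expC_i.
set z := Csum _ _; rewrite normc_expC.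
have zs : normc z <= 2 * s.
  apply/ler_addgt0Pr => e e0.
  have [U [uU _ US HU]] := Csum_approx _ lam [::] e sS e0 ltac:(by []).
  have := HU _ (fun u => normc_mulc_cis_sub1 (lam u) (t * u)).
  rewrite -/z; set w := \sum_(u <- U) _ => h.
  have : normc w <= 2 * s.
    apply: le_trans (normc_sum _ _ _ _) _.
    apply: (@le_trans _ _ (\sum_(u <- U) 2 * `|lam u|)).
      by apply: ler_sum => u _; exact: normc_mulc_cis_sub1.
    rewrite -mulr_sumr ler_wpM2l// -lee_fin; apply: le_trans lams.
    exact: (seq_sum_le_esum _ U (fun u => `|lam u|)).
  by have := normc_triangle_sub z w; lra.
apply: le_trans (expR_ge1Dx _); rewrite lerD2l.
rewrite ReD (_ : complex.Re _ = 0) ?add0r; last by simpc.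
by have := Re_normc z; rewrite ler_norml => /andP[+ _]; lra.
Qed.

(** The two atoms are in opposite phase and contribute [|p l - p k|] in place of [p k + p l], a loss
    of twice the smaller weight. *)
Lemma normc_char_fun_two_atoms F x p k l (c t : R) : discrete_rep F x p ->
  k != l -> c <= p k -> c <= p l -> t * (x k - x l) = pi ->
  normc (char_fun F t) <= 1 - 2 * c.
Proof.
move=> rF kl ck cl tpi; have [_ p0 _ _] := rF.
apply/ler_addgt0Pr => e e0.
have [m hm] := discrete_rep_tail F x p (e / 2) rF ltac:(lra).
pose n := maxn m (maxn k l).+1.
have /andP[t1 pn] := hm n (leq_maxl _ _).
have kn : (k < n)%N by rewrite leq_max ltnS leq_maxl orbT.
have ln : (l < n)%N by rewrite leq_max ltnS leq_maxr orbT.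
have := char_fun_trunc F x p t n rF; set S := \sum_(j < n) _ => hS.
suff : normc S <= 1 - 2 * c by have := normc_triangle_sub (char_fun F t) S; lra.
have lk : Ordinal ln != Ordinal kn by rewrite eq_sym -val_eqE.
move: pn; rewrite /S (bigD1 (Ordinal kn))//= (bigD1 (Ordinal ln))//=.
rewrite [in X in _ -> X](bigD1 (Ordinal kn))//= [in X in _ -> X](bigD1 (Ordinal ln))//=.
set P := \sum_(i < n | _) p i; set Q := \sum_(i < n | _) _ * _ => hP.
have QP : normc Q <= P.
  apply: le_trans (normc_sum _ _ _ _) _; apply: ler_sum => j _.
  by rewrite normcM normc_cis mulr1 normc_real ger0_norm.
have -> : cis (t * x k) = - cis (t * x l).
  have -> : t * x k = t * x l + pi by rewrite -tpi; ring.
  by rewrite /cis cosDpi sinDpi; simpc.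
have -> : (p k)%:C%C * - cis (t * x l) + ((p l)%:C%C * cis (t * x l) + Q) =
    (p l - p k)%:C%C * cis (t * x l) + Q by rewrite rmorphB/=; ring.
apply: le_trans (normcD_le _ _) _; rewrite normcM normc_cis mulr1 normc_real.
have : `|p l - p k| <= p k + p l - 2 * c by rewrite ler_norml; apply/andP; split; lra.
lra.
Qed.

(** * Jumps under convergence in variation *)

Lemma total_variationR_jump F G (a e : R) : 0 <= e ->
  (`|(F a - F (a - e)) - (G a - G (a - e))|%:E
    <= total_variationR ((F : R -> R) \- (G : R -> R))%R)%E.
Proof.
move=> e0; have ae : a - e <= a by lra.
have -> : (F a - F (a - e)) - (G a - G (a - e)) =
  ((F : R -> R) \- (G : R -> R)) a - ((F : R -> R) \- (G : R -> R)) (a - e).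
  by rewrite /=; ring.
apply: le_trans (total_variation_ge _ ae) _.
by apply: ereal_sup_ubound; exists (a - e, a).
Qed.

(** [N] depends neither on the point nor on the width [e], so atoms can be transferred between [G]
    and [F n]. *)
Lemma cvg_in_variation_jump (F : nat -> distribution_function R) G (d : R) :
  cvg_in_variation F G -> 0 < d -> exists N, forall n, (N <= n)%N ->
  forall a e : R, 0 < e ->
    `|(F n a - F n (a - e)) - (G a - G (a - e))| <= d.
Proof.
move=> /fine_cvgP[finTV /cvgrPdist_le cTV] d0.
have [N1 _ h1] := finTV; have [N2 _ h2] := cTV d d0.
exists (maxn N1 N2) => n; rewrite geq_max => /andP[/h1/= f1 /h2/= f2] a e e0.
rewrite -lee_fin; apply: le_trans (total_variationR_jump (F n) G a e (ltW e0)) _.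
rewrite -(fineK f1) lee_fin; apply: le_trans (ler_norm _) _.
by move: f2; rewrite sub0r normrN.
Qed.

Lemma growth_points_jump G a : growth_points G a ->
  exists2 c : R, 0 < c & forall e, 0 < e -> c <= G a - G (a - e).
Proof.
move=> [x [p [rG [k -> pk]]]]; exists (p k) => // e e0.
exact: discrete_jump_ge rG e0.
Qed.

(** By injectivity of [x], two positive weights would yield two points of growth; a single index
    thus carries the whole mass. *)
Lemma degenerate_atom G x p : discrete_rep G x p -> ~ Defs.nondegenerate G ->
  exists k, p k = 1.
Proof.
move=> rG dG; have [xi p0 p1 _] := rG.
have [k pk] : exists k, 0 < p k.
  apply: contrapT => /forallNP np.
  move: p1; rewrite eseries0; first by move=> [] /eqP; rewrite eq_sym oner_eq0.
  move=> k _ _; congr EFin; apply/eqP; rewrite eq_le p0 andbT leNgt.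
  by apply/negP; exact: np.
have pj j : j != k -> p j = 0.
  move=> jk; apply/eqP; rewrite eq_le p0 andbT leNgt; apply/negP => pj.
  apply: dG; exists (x j), (x k); split; last by rewrite (inj_eq xi).
    by exists x, p; split => //; exists j.
  by exists x, p; split => //; exists k.
exists k; apply/eqP; rewrite eq_le; apply/andP; split.
  have [m /(_ (maxn m k.+1) (leq_maxl _ _))/andP[_]] := discrete_rep_tail G x p 1 rG ltr01.
  have kn : (k < maxn m k.+1)%N by rewrite leq_max ltnSn orbT.
  by rewrite (bigD1 (Ordinal kn))//= big1 ?addr0// => j jk; apply: pj.
apply/ler_addgt0Pr => e e0.
have [m /(_ (maxn m k.+1) (leq_maxl _ _))/andP[+ _]] := discrete_rep_tail G x p e rG e0.
have kn : (k < maxn m k.+1)%N by rewrite leq_max ltnSn orbT.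
rewrite (bigD1 (Ordinal kn))//= big1 ?addr0; first lra.
by move=> j jk; apply: pj.
Qed.

(** * Subsequences and the limit inferior *)

Lemma subseq_index_ge phi n : subseq_index phi -> (n <= phi n)%N.
Proof.
move=> hphi; elim: n => // n IH; apply: leq_ltn_trans IH _; exact: hphi.
Qed.

Lemma limn_einf_gt0 (u : nat -> \bar R) : (0 < limn_einf u)%E ->
  exists2 c : R, 0 < c & exists N, forall n, (N <= n)%N -> (c%:E <= u n)%E.
Proof.
rewrite limn_einf_lim (cvg_lim _ (@cvg_einfs_sup R u))//.
move=> /ereal_sup_gt[_ [N _ <-]] h.
have un n : (N <= n)%N -> (einfs u N <= u n)%E.
  by move=> Nn; apply: ereal_inf_lbound; exists n.
move: h un; case: (einfs u N) => [c||//] c0 un.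
  by exists c => //; exists N.
(* The infimum may be [+oo]; any positive constant then works. *)
by exists 1 => //; exists N => n /un; apply: le_trans; rewrite leey.
Qed.

Lemma limn_einf_le0 (u : nat -> \bar R) : ~~ (0 < limn_einf u)%E ->
  forall (e : R) N, 0 < e -> exists2 n, (N < n)%N & (u n < e%:E)%E.
Proof.
rewrite limn_einf_lim (cvg_lim _ (@cvg_einfs_sup R u))// -leNgt => u0 e N e0.
have : (einfs u N.+1 < e%:E)%E.
  apply: (@le_lt_trans _ _ 0%E); last by rewrite lte_fin.
  by apply: le_trans u0; apply: ereal_sup_ubound; exists N.+1.
by move=> /ereal_inf_lt[_ [n Nn <-] ue]; exists n.
Qed.

Lemma small_subseq (u : nat -> \bar R) : ~~ (0 < limn_einf u)%E ->
  exists2 phi, subseq_index phi & forall k, (u (phi k) < (k.+1%:R^-1)%:E)%E.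
Proof.
move=> /limn_einf_le0 hu.
have /choice[f hf] (kN : nat * nat) :
    exists n, (kN.2 < n)%N /\ (u n < (kN.1.+1%:R^-1)%:E)%E.
  have [|n ? ?] := hu (kN.1.+1%:R^-1) kN.2; first by rewrite invr_gt0.
  by exists n.
pose phi := fix phi k := if k is k'.+1 then f (k, phi k') else f (0, 0)%N.
exists phi; last by case=> [|k]; [case: (hf (0, 0)%N)|case: (hf (k.+1, phi k))].
by apply: homo_ltn => [|k]; [exact: ltn_trans|case: (hf (k.+1, phi k))].
Qed.

End compactness.

Theorem theorem6 (R : realType) (F : nat -> distribution_function R)
    (gam : nat -> R) (lam : nat -> R -> R)
    (FDS : forall n, DS (F n))
    (Fspec : forall n, spectral_rep (F n) (gam n) (lam n)) :
  DS_stochastically_compact F <->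
  DS_relatively_compact F /\
  (0 < limn_einf (fun n =>
         \esum_(u in spectral_support (F n)) `|lam n u|%:E))%E.
Proof.
set s := fun n => \esum_(u in spectral_support (F n)) `|lam n u|%:E.
split=> [FC|[FC s0] phi hphi].
  split.
    by move=> phi /FC[psi [G [hpsi GDS _ cG]]]; exists psi, G.
  apply: contraT => /small_subseq[phi hphi sphi].
  have [psi [G [hpsi _ [a [b [Ga Gb ab]]] cG]]] := FC phi hphi.
  have [c1 c10 Gc1] := growth_points_jump G a Ga.
  have [c2 c20 Gc2] := growth_points_jump G b Gb.
  pose c := Num.min c1 c2.
  have c0 : 0 < c by rewrite lt_min c10.
  have cc1 : c <= c1 by rewrite ge_min lexx.
  have cc2 : c <= c2 by rewrite ge_min lexx orbT.
  (* Jumps of [G] of size at least [c] leave jumps of size [3/4 * c] for [F m], hence atoms of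
     weight at least [c / 2]. *)
  have [N hN] := cvg_in_variation_jump _ G (c / 4) cG ltac:(lra).
  (* Ensures [1 / (psi n + 1) < c / 2], so the lower bound on the characteristic function exceeds
     the upper bound [1 - c]. *)
  pose n := maxn N (Num.truncn (2 / c)).
  have {}hN := hN n (leq_maxl _ _).
  set m := phi (psi n); rewrite -[(F \o phi \o psi) n]/(F m) in hN.
  have [[x [p rF]] _] := FDS m.
  have [|||k xk ck] := discrete_jump_atom (F m) x p a (3 / 4 * c) (c / 2) rF.
  - move=> e e0; have := hN a e e0; have := Gc1 e e0.
    by rewrite ler_norml => ? /andP[? ?]; lra.
  - lra.
  - lra.
  have [|||l xl cl] := discrete_jump_atom (F m) x p b (3 / 4 * c) (c / 2) rF.
  - move=> e e0; have := hN b e e0; have := Gc2 e e0.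
    by rewrite ler_norml => ? /andP[? ?]; lra.
  - lra.
  - lra.
  have kl : k != l by apply: contraNneq ab => kl; rewrite -xk -xl kl.
  pose t := pi / (a - b).
  have := @normc_char_fun_two_atoms R (F m) x p k l (c / 2) t rF kl ck cl.
  rewrite xk xl divfK ?subr_eq0// => /(_ erefl) ub.
  have lb := normc_char_fun_ge (F m) _ _ t _ (Fspec m) (ltW (sphi (psi n))).
  have : (psi n).+1%:R^-1 < c / 2.
    rewrite invf_plt ?posrE//; last lra.
    rewrite invf_div; apply: lt_le_trans (truncnS_gt _) _.
    rewrite ler_nat ltnS; apply: leq_trans (leq_maxr N _) _.
    exact: subseq_index_ge.
  move: lb; move: (_^-1 : R) => v lb nc; exfalso.
  lra.
have [psi [G [hpsi GDS cG]]] := FC phi hphi.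
exists psi, G; split => //; apply: contrapT => dG.
have [[y [q rG]] _] := GDS.
have [i qi] := degenerate_atom G y q rG dG.
have [c c0 [N1 hN1]] := limn_einf_gt0 _ s0.
(* The spectral mass will be at most [4 * d <= c / 2], against the eventual lower bound [c]. *)
pose d := Num.min (1/256) (c / 8).
have d0 : 0 < d by rewrite lt_min; apply/andP; split; lra.
have d256 : d <= 1/256 by rewrite ge_min lexx.
have dc : d <= c / 8 by rewrite ge_min lexx orbT.
(* The unit jump of [G] at [y i] leaves a jump of at least [1 - d / 2] for [F m], hence an atom of
   weight at least [1 - d]. *)
have [N2 hN2] := cvg_in_variation_jump _ G (d / 2) cG ltac:(lra).
pose n := maxn N1 N2.
have {}hN2 := hN2 n (leq_maxr _ _).
set m := phi (psi n); rewrite -[(F \o phi \o psi) n]/(F m) in hN2.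
have N1m : (N1 <= m)%N.
  apply: leq_trans (leq_maxl N1 N2) _.
  exact: leq_trans (subseq_index_ge _ _ hpsi) (subseq_index_ge _ _ hphi).
have [[x [p rF]] _] := FDS m.
have [|||k xk pk] := discrete_jump_atom (F m) x p (y i) (1 - d / 2) (1 - d) rF.
- move=> e e0; have := hN2 (y i) e e0; have := discrete_jump_ge G y q i e rG e0.
  by rewrite qi ler_norml => ? /andP[? ?]; lra.
- lra.
- lra.
have := le_trans (hN1 m N1m)
  (spectral_esum_le (F m) _ _ x p k d (Fspec m) rF pk (ltW d0) d256).
by rewrite lee_fin; lra.
Qed.
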